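(* Let $A, B$ be rearrangement-invariant quasi-Banach function spaces over a completely atomic measure space $(\mathcal{R}, \mu)$ all of whose atoms have the same measure $\beta\in(0,\infty)$. Assume that the Hardy--Littlewood--Pólya principle holds for both $A$ and $B$. Let $\lVert \cdot \rVert_{\overline{A}}$, $\lVert \cdot \rVert_{\overline{B}}$ be the canonical representation quasinorms (over $([0,\infty),\lambda)$) of $\lVert\cdot\rVert_A$, $\lVert\cdot\rVert_B$. Then there are constants $0 < c \leq C < \infty$, depending only on the quasinorms $\lVert\cdot\rVert_A,\lVert\cdot\rVert_B$, such that for every $f \in \mathcal{M}(\mathcal{R}, \mu)$ $$c\,\lVert f^* \rVert_{\overline{A} + \overline{B}} \leq \lVert f \rVert_{A+B} \leq C\, \lVert f^* \rVert_{\overline{A} + \overline{B}}.$$ Furthermore, the functional $f \mapsto \lVert f^* \rVert_{\overline{A} + \overline{B}}$ on $\mathcal{M}(\mathcal{R},\mu)$ is a quasinorm, has the lattice property, is finite on $\chi_E$ for every measurable $E\subseteq\mathcal{R}$ with $\mu(E)<\infty$, and is rearrangement-invariant; and it has the local $L^1$ property if and only if $\lVert\cdot\rVert_{A+B}$ has the local $L^1$ property.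
   Context: Measure spaces are $\sigma$-finite. $\lambda$ is Lebesgue measure on $[0,\infty)$. $\mathcal{M}(\mathcal{R},\mu)$ is the set of ($\mu$-a.e. equivalence classes of) measurable functions on $\mathcal{R}$ (infinite values are allowed), and $\mathcal{M}_+$ its cone of non-negative functions. The non-increasing rearrangement of $f$ is $f^*(t)=\inf\{s\ge 0:\ \mu(\{|f|>s\})\le t\}$, $t\in[0,\infty)$. Properties of a functional $\lVert\cdot\rVert:\mathcal{M}(\mathcal{R},\mu)\to[0,\infty]$ with $\lVert\,|f|\,\rVert=\lVert f\rVert$: - quasinorm: $\lVert af\rVert=|a|\lVert f\rVert$ for $a\in\mathbb{C}$, $f \in \mathcal{M}_+$; $\lVert f\rVert=0\Leftrightarrow f=0$ a.e.; there is $K\ge1$ with $\lVert f+g\rVert\le K(\lVert f\rVert+\lVert g\rVert)$ for all $f,g\in\mathcal{M}_+$; - lattice property: $0\le f\le g$ a.e. implies $\lVert f\rVert\le\lVert g\rVert$; - Fatou property: $0\le f_n\uparrow f$ a.e. implies $\lVert f_n\rVert\uparrow\lVert f\rVert$; - finiteness on finite-measure sets: $\lVert\chi_E\rVert<\infty$ whenever $\mu(E)<\infty$; - local $L^1$ property: for every $E$ with $\mu(E)<\infty$ there is $C_E<\infty$ such that $\int_E f\,d\mu\le C_E\lVert f\rVert$ for all $f\in\mathcal{M}_+$; - rearrangement-invariance (r.i.): $\lVert f\rVert=\lVert g\rVert$ whenever $f^*=g^*$. An r.i. quasi-Banach function norm is such a functional that is a quasinorm, has the lattice and Fatou properties, is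 finite on finite-measure sets and is rearrangement-invariant; the corresponding r.i. quasi-Banach function space is $X=\{f\in\mathcal{M}(\mathcal{R},\mu):\lVert f\rVert_X<\infty\}$. Hardy--Littlewood--Pólya principle for $X$: whenever $f,g\in\mathcal{M}(\mathcal{R},\mu)$ satisfy $\int_0^t f^*\,d\lambda\le\int_0^t g^*\,d\lambda$ for all $t>0$, then $\lVert f\rVert_X\le\lVert g\rVert_X$. Sum: for two such spaces $A,B$ over the same measure space, $A+B=\{f: \exists f_A\in A, f_B\in B,\ f=f_A+f_B\}$ and $\lVert f\rVert_{A+B}=\inf\{\lVert f_A\rVert_A+\lVert f_B\rVert_B:\ f=f_A+f_B,\ f_A\in A,\ f_B\in B\}$ (with $\inf\emptyset=\infty$). Canonical representation quasinorm (completely atomic case): enumerate the atoms of $\mathcal{R}$ as $e_n$, $n\in\{0,1,2,\dots\}$, $(n+1)\beta\le\mu(\mathcal{R})$. For $g\in\mathcal{M}([0,\infty),\lambda)$ let $\widetilde g\in\mathcal{M}(\mathcal{R},\mu)$ be given by $\widetilde g(e_n)=\frac1\beta\int_{n\beta}^{(n+1)\beta}g^*\,d\lambda$, and put $\lVert g\rVert_{\overline{X}}=\lVert\widetilde g\rVert_X$. This does not depend on the enumeration, it is an r.i. quasi-Banach function norm over $([0,\infty),\lambda)$, and $\lVert f\rVert_X=\lVert f^*\rVert_{\overline{X}}$ for all $f\in\mathcal{M}(\mathcal{R},\mu)$. $\overline{X}$ denotes the corresponding space. *)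

(* Defs.v *)
From HB Require Import structures.
From mathcomp Require Import all_boot all_order all_algebra.
From mathcomp Require Import complex.
From mathcomp Require Import all_classical all_reals all_analysis.

Set Implicit Arguments.
Unset Strict Implicit.
Unset Printing Implicit Defensive.

Import Order.TTheory GRing.Theory Num.Theory.
Import numFieldTopology.Exports numFieldNormedType.Exports.

Local Open Scope classical_set_scope.
Local Open Scope ring_scope.
Local Open Scope ereal_scope.

(* Extended complex numbers: the complex numbers together with one infinite
   value, [None]. *)
Definition ecomplex (R : realType) : Type := option (complex R).

Definition emod (R : realType) (z : ecomplex R) : \bar R :=
  if z is Some w then (complex.Re `|w|%R)%:E else +oo.

(* The embedding of [0, +oo] into the extended complex numbers; the value at
   -oo is irrelevant. *)
Definition of_ereal (R : realType) (x : \bar R) : ecomplex R :=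
  if x is r%:E then Some (Complex r 0%R) else None.

Definition ecadd (R : realType) (z w : ecomplex R) : ecomplex R :=
  match z, w with Some a, Some b => Some (a + b)%R | _, _ => None end.

(* As usual in measure theory, 0 * oo = 0. *)
Definition ecscale (R : realType) (a : complex R) (z : ecomplex R) :
    ecomplex R :=
  if z is Some w then Some (a * w)%R
  else if a == 0%R then Some 0%R else None.

Definition ecmeasurable (R : realType) d (T : measurableType d)
    (f : T -> ecomplex R) : Prop :=
  [/\ measurable [set x | f x = None],
      measurable_fun setT (fun x => complex.Re (odflt 0%R (f x))) &
      measurable_fun setT (fun x => complex.Im (odflt 0%R (f x)))].

Definition eabs (R : realType) (T : Type) (f : T -> ecomplex R) :
    T -> ecomplex R := fun x => of_ereal (emod (f x)).

Definition chi (R : realType) (T : Type) (E : set T) : T -> ecomplex R :=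
  fun x => of_ereal (\1_E x)%:E.

(* A [functional] is an arbitrary map on functions; only its values at
   measurable functions matter. *)
Definition functional (R : realType) (T : Type) : Type :=
  (T -> ecomplex R) -> \bar R.

Section Functionals.
Context (R : realType) d (T : measurableType d).
Variable mu : {measure set T -> \bar R}.
Implicit Types (f g : T -> ecomplex R) (N : functional R T).

Definition nonneg_fun f : Prop :=
  ecmeasurable f /\ {ae mu, forall x, f x = of_ereal (emod (f x))}.

Definition rearr f (t : R) : \bar R :=
  ereal_inf [set s%:E | s in
    [set s : R | (0 <= s)%R /\ mu [set x | s%:E < emod (f x)] <= t%:E]].

(* Well defined on a.e. classes of measurable functions, with values in
   [0, +oo], and depending only on the absolute value. *)
Definition is_functional N : Prop :=
  [/\ forall f, ecmeasurable f -> 0 <= N f,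
      forall f g, ecmeasurable f -> ecmeasurable g ->
        {ae mu, forall x, f x = g x} -> N f = N g &
      forall f, ecmeasurable f -> N (eabs f) = N f].

Definition quasinorm N : Prop :=
  [/\ forall (a : complex R) f, nonneg_fun f ->
        N (fun x => ecscale a (f x)) = emod (Some a) * N f,
      forall f, ecmeasurable f ->
        (N f = 0 <-> {ae mu, forall x, f x = Some 0%R}) &
      exists K : R, (1 <= K)%R /\
        forall f g, nonneg_fun f -> nonneg_fun g ->
          N (fun x => ecadd (f x) (g x)) <= K%:E * (N f + N g)].

Definition lattice_property N : Prop :=
  forall f g, nonneg_fun f -> nonneg_fun g ->
    {ae mu, forall x, emod (f x) <= emod (g x)} -> N f <= N g.

Definition fatou_property N : Prop :=
  forall (f_ : nat -> T -> ecomplex R) f,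
    (forall n, nonneg_fun (f_ n)) -> nonneg_fun f ->
    {ae mu, forall x,
      (forall m n, (m <= n)%N -> emod (f_ m x) <= emod (f_ n x)) /\
      emod (f_ n x) @[n --> \oo] --> emod (f x)} ->
    (forall m n, (m <= n)%N -> N (f_ m) <= N (f_ n)) /\
    N (f_ n) @[n --> \oo] --> N f.

Definition finite_on_finite_sets N : Prop :=
  forall E, measurable E -> mu E < +oo -> N (chi R E) < +oo.

Definition local_L1 N : Prop :=
  forall E, measurable E -> mu E < +oo ->
    exists C : R, forall f, nonneg_fun f ->
      \int[mu]_(x in E) emod (f x) <= C%:E * N f.

Definition rearrangement_invariant N : Prop :=
  forall f g, ecmeasurable f -> ecmeasurable g ->
    (forall t : R, (0 <= t)%R -> rearr f t = rearr g t) -> N f = N g.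

Record ri_quasi_Banach_norm N : Prop := RiQuasiBanachNorm {
  riq_functional : is_functional N;
  riq_quasinorm : quasinorm N;
  riq_lattice : lattice_property N;
  riq_fatou : fatou_property N;
  riq_finite : finite_on_finite_sets N;
  riq_ri : rearrangement_invariant N }.

Definition HLP_principle N : Prop :=
  forall f g, ecmeasurable f -> ecmeasurable g ->
    (forall t : R, (0 < t)%R ->
       \int[lebesgue_measure]_(s in `[0%R, t]) rearr f s <=
       \int[lebesgue_measure]_(s in `[0%R, t]) rearr g s) ->
    N f <= N g.

Definition space N : set (T -> ecomplex R) :=
  [set f | ecmeasurable f /\ N f < +oo].

Definition sum_norm NA NB : functional R T := fun f =>
  ereal_inf [set r | exists fA fB,
    [/\ space NA fA, space NB fB,
        {ae mu, forall x, f x = ecadd (fA x) (fB x)} &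
        r = NA fA + NB fB]].

Definition is_atom (E : set T) : Prop :=
  [/\ measurable E, 0 < mu E &
      forall F, measurable F -> F `<=` E -> mu F = 0 \/ mu F = mu E].

Definition completely_atomic : Prop :=
  forall E, measurable E -> 0 < mu E -> exists2 F, F `<=` E & is_atom F.

Definition atom_index (beta : R) (n : nat) : bool :=
  (n.+1%:R * beta)%:E <= mu [set: T].

(* Atoms are only determined up to null sets. *)
Definition atom_enumeration (beta : R) (e : nat -> set T) : Prop :=
  [/\ forall n, atom_index beta n -> is_atom (e n),
      trivIset [set n | atom_index beta n] e &
      mu (~` \bigcup_(n in [set n | atom_index beta n]) e n) = 0].

(* The choice of enumeration is immaterial for the canonical quasinorm below,
   by rearrangement-invariance. *)
Definition atoms (beta : R) : nat -> set T :=
  xget (fun=> set0) [set e | atom_enumeration beta e].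

End Functionals.

(* The measure space ([0, +oo), Lebesgue), realised as the real line with
   Lebesgue measure restricted to [0, +oo). *)
Definition halfline (R : realType) : {measure set (measurableTypeR R) -> \bar R} :=
  mrestr lebesgue_measure (measurable_itv `[(0 : R)%R, +oo[).

Section Canonical.
Context (R : realType) d (T : measurableType d).
Variables (mu : {measure set T -> \bar R}) (beta : R).

Definition atom_average (g : measurableTypeR R -> ecomplex R) (n : nat) : \bar R :=
  (beta^-1)%:E *
  \int[lebesgue_measure]_(s in `[(n%:R * beta)%R, (n.+1%:R * beta)%R])
    rearr (halfline R) g s.

(* The function with the constant value [atom_average g n] on the n-th atom. *)
Definition tilde (g : measurableTypeR R -> ecomplex R) : T -> ecomplex R := fun x =>
  of_ereal (\sum_(0 <= n <oo | atom_index mu beta n)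
              atom_average g n * (\1_(atoms mu beta n) x)%:E).

Definition canonical_norm (N : functional R T) : functional R (measurableTypeR R) :=
  fun g => N (tilde g).

(* f |-> || f^* ||, the norm being that of the sum of the canonical
   representation spaces. *)
Definition canonical_sum_norm (NA NB : functional R T) : functional R T :=
  fun f => sum_norm (halfline R) (canonical_norm NA) (canonical_norm NB)
             (fun t => of_ereal (rearr mu f t)).

End Canonical.

(* Main.v *)
(** Everything is reduced to distribution functions.  By the
    Hardy-Littlewood-Polya principle, mu {|f| > s} <= c mu {|g| > s} for all
    s > 0 (with c >= 1) implies ||f|| <= c ||g||, because then f^*(t) <= g^*(t/c)
    and the integral of g^*(s/c) over [0, t] is at most that of c g^*.

    If f = fA + fB, then f^*(t) <= fA^*(t/2) + fB^*(t/2), so f^* splits into two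
    parts dominated by dilates of fA^* and fB^*, whose atom averages have a
    distribution function at most three times that of fA and fB.

    Conversely, if f^* = gA + gB, then for every level r either
    mu {|f| >= r} <= 2 lambda {|gA| >= r/2} or the same holds with gB.  Splitting
    f according to which alternative holds at the level r = |f(x)| gives
    f = fA + fB with mu {|fA| > s} <= 2 lambda {|gA| > s/2}, and likewise for fB;
    this uses no measure-preserving map carrying f^* back to f, which need not
    exist.  The right-hand side is compared with the atom averages of gA^*,
    using that a set of positive measure has measure at least beta. *)
Require Import Defs.
From HB Require Import structures.
From mathcomp Require Import all_boot all_order all_algebra.
From mathcomp Require Import all_classical all_reals all_analysis.
From mathcomp Require Import measurable_realfun.
From mathcomp Require Import complex ring lra.

Set Implicit Arguments.
Unset Strict Implicit.
Unset Printing Implicit Defensive.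

Import Order.TTheory GRing.Theory Num.Theory.
Import numFieldTopology.Exports numFieldNormedType.Exports.

Local Open Scope classical_set_scope.
Local Open Scope ring_scope.
Local Open Scope ereal_scope.

(** * Extended complex numbers *)

Section ExtendedComplex.
Context (R : realType).
Implicit Types (z w : ecomplex R) (x y : \bar R).

Lemma emodE (w : complex R) : emod (Some w) = (Normc.normc w)%:E.
Proof. by []. Qed.

Lemma emod_real (r : R) : emod (Some (Complex r 0%R)) = `|r|%:E.
Proof. by rewrite emodE /= expr0n addr0 sqrtr_sqr. Qed.

Lemma emod_ge0 z : 0 <= emod z.
Proof. by case: z => [[a b]|]//=; rewrite lee_fin sqrtr_ge0. Qed.

Lemma emod_of_ereal x : 0 <= x -> emod (of_ereal x) = x.
Proof. by case: x => //= r r0; rewrite expr0n addr0 sqrtr_sqr ger0_norm. Qed.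

Lemma emod0 : emod (Some 0%R : ecomplex R) = 0.
Proof. by rewrite emodE Normc.normc0. Qed.

Lemma emod_eq0 z : emod z = 0 -> z = Some 0%R.
Proof. by case: z => [w|]//; rewrite emodE => -[/Normc.eq0_normc ->]. Qed.

Lemma emod_ecadd z w : emod (ecadd z w) <= emod z + emod w.
Proof.
by case: z w => [z|] [w|]//; rewrite /ecadd !emodE -EFinD lee_fin; exact: le_normcD.
Qed.

Lemma emod_ecscale a z : emod (ecscale a z) = emod (Some a) * emod z.
Proof.
case: z => [z|]; first by rewrite /ecscale !emodE Normc.normcM.
rewrite /ecscale; have [->|a0] := eqVneq; first by rewrite !emod0 mul0e.
rewrite (_ : emod (None : ecomplex R) = +oo)// gt0_muley// lt0e emod_ge0 andbT.
by apply: contra_neq a0 => /emod_eq0 [].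
Qed.

Lemma normc_gt0 (a : complex R) : a != 0%R -> (0 < Normc.normc a)%R.
Proof.
move=> a0; rewrite -lte_fin -emodE lt0e emod_ge0 andbT.
by apply: contra_neq a0 => /emod_eq0[].
Qed.

Lemma ecaddA : associative (@ecadd R).
Proof. by case=> [a|] [b|] [c|]//=; rewrite addrA. Qed.

Lemma ecaddC : commutative (@ecadd R).
Proof. by case=> [a|] [b|]//=; rewrite addrC. Qed.

Lemma ecaddr0 z : ecadd z (Some 0%R) = z.
Proof. by case: z => //= z; rewrite addr0. Qed.

Lemma ecadd_of_ereal x y : 0 <= x -> 0 <= y ->
  ecadd (of_ereal x) (of_ereal y) = of_ereal (x + y).
Proof. by case: x y => [x||] [y||]//=; rewrite /GRing.add/= addr0. Qed.

Lemma ecscale_of_ereal (c : R) x : (0 <= c)%R -> 0 <= x ->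
  ecscale (Complex c 0%R) (of_ereal x) = of_ereal (c%:E * x).
Proof.
move=> c0; case: x => [x||]//= _.
  by rewrite /GRing.mul/= !mulr0 mul0r subr0 addr0.
rewrite eq_complex/= eqxx andbT; have [->|cn0] := eqVneq; first by rewrite mul0e.
by rewrite gt0_muley// lte_fin lt0r cn0.
Qed.

Lemma ecscaleD a z w : ecscale a (ecadd z w) = ecadd (ecscale a z) (ecscale a w).
Proof.
case: z w => [z|] [w|]//=; rewrite ?mulrDr//; have [a0|] := eqVneq a 0%R => //=;
  by rewrite ?a0 ?mul0r ?addr0.
Qed.

Lemma ecscaleK a z : a != 0%R -> ecscale (a^-1)%R (ecscale a z) = z.
Proof.
move=> a0; case: z => [z|] /=; first by rewrite mulKf.
by rewrite (negbTE a0)/= invr_eq0 (negbTE a0).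
Qed.

Lemma ecscale0 z : ecscale 0%R z = Some 0%R.
Proof. by case: z => [z|]/=; rewrite ?mul0r ?eqxx. Qed.

End ExtendedComplex.

(** * Measurability of functions with extended complex values *)

Section Measurability.
Context (R : realType) d (T : measurableType d).
Implicit Types (f g : T -> ecomplex R) (h : T -> \bar R).

Lemma measurable_fun_mem (D : set T) : measurable D ->
  measurable_fun setT (fun x => x \in D).
Proof.
move=> mD; apply: (measurable_fun_bool true); rewrite setTI.
by rewrite (_ : _ @^-1` _ = D)//; apply/seteqP; split => x/= => [/set_mem|/mem_set].
Qed.

Lemma measurable_emod f : ecmeasurable f ->
  measurable_fun setT (fun x => emod (f x)).
Proof.
move=> [mN mr mi].
pose n x := (Num.sqrt ((complex.Re (odflt 0 (f x))) ^+ 2 +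
  (complex.Im (odflt 0 (f x))) ^+ 2))%R.
rewrite (_ : (fun x => emod (f x)) =
    (fun x => if x \in [set x | f x = None] then +oo else (n x)%:E)); last first.
  apply/funext => x; case: ifPn; first by rewrite inE => /= ->.
  by rewrite notin_setE /n/=; case: (f x) => [[a b]|]//=.
apply: measurable_fun_ifT => //.
  exact: measurable_fun_mem.
apply/measurable_EFinP.
apply: (@measurableT_comp _ _ _ _ _ _ (@Num.sqrt R)).
  by apply: continuous_measurable_fun; exact: sqrt_continuous.
by apply: measurable_funD; exact: measurable_funX.
Qed.

Lemma ecmeasurable_of_ereal h : measurable_fun setT h ->
  ecmeasurable (fun x => of_ereal (h x)).
Proof.
move=> mh; split.
- rewrite (_ : [set x | _] = ~` (setT `&` [set x | h x \is a fin_num])).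
    exact/measurableC/emeasurable_fin_num.
  by rewrite setTI; apply/seteqP; split => x/=; case: (h x).
- rewrite (_ : (fun x => _) = fine \o h).
    exact: measurableT_comp.
  by apply/funext => x/=; case: (h x).
- rewrite (_ : (fun x => _) = cst 0%R); first exact: measurable_cst.
  by apply/funext => x/=; case: (h x).
Qed.

Lemma ecmeasurable_cst (z : ecomplex R) : ecmeasurable (fun _ : T => z).
Proof.
split; [|exact: measurable_cst..].
by case: z => [z|]; [rewrite (_ : mkset _ = set0)|rewrite (_ : mkset _ = setT)];
  rewrite // eqEsubset; split.
Qed.

Lemma ecmeasurable_eabs f : ecmeasurable f -> ecmeasurable (eabs f).
Proof. by move=> mf; exact/ecmeasurable_of_ereal/measurable_emod. Qed.

Lemma ecmeasurable_ecscale a f : ecmeasurable f ->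
  ecmeasurable (fun x => ecscale a (f x)).
Proof.
have [->|a0] := eqVneq a 0%R => mf.
  by rewrite (_ : (fun x => _) = (fun=> Some 0%R));
    [exact: ecmeasurable_cst|apply/funext => x; rewrite ecscale0].
have [mN mr mi] := mf; case: a a0 => a b a0.
split.
- rewrite (_ : [set x | _] = [set x | f x = None])//.
  by apply/seteqP; split => x/=; case: (f x) => //=; rewrite (negbTE a0).
- rewrite (_ : (fun x => _) = (fun x => a * complex.Re (odflt 0 (f x)) -
    b * complex.Im (odflt 0 (f x))))%R.
    by apply: measurable_funB; apply: measurable_funM.
  apply/funext => x; case: (f x) => [[]|]//=; rewrite (negbTE a0)/=.
  by rewrite !mulr0 subr0.
- rewrite (_ : (fun x => _) = (fun x => a * complex.Im (odflt 0 (f x)) +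
    b * complex.Re (odflt 0 (f x))))%R.
    by apply: measurable_funD; apply: measurable_funM.
  apply/funext => x; case: (f x) => [[]|]//=; rewrite (negbTE a0)/=.
  by rewrite !mulr0 addr0.
Qed.

Lemma ecmeasurable_restrict (D : set T) f : measurable D -> ecmeasurable f ->
  ecmeasurable (fun x => if x \in D then f x else Some 0%R).
Proof.
move=> mD [mN mr mi].
have mb := measurable_fun_mem mD.
split.
- rewrite (_ : [set x | _] = D `&` [set x | f x = None]); first exact: measurableI.
  apply/seteqP; split => x/=; first by case: ifPn => //; rewrite inE.
  by move=> [xD ->]; rewrite mem_set.
- under eq_fun do rewrite (fun_if (fun z => complex.Re (odflt 0%R z)))/=.
  exact: measurable_fun_ifT.
- under eq_fun do rewrite (fun_if (fun z => complex.Im (odflt 0%R z)))/=.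
  exact: measurable_fun_ifT.
Qed.

Lemma ecmeasurable_ecadd f g : ecmeasurable f -> ecmeasurable g ->
  ecmeasurable (fun x => ecadd (f x) (g x)).
Proof.
move=> [mNf mrf mif] [mNg mrg mig].
set N := [set x | f x = None] `|` [set x | g x = None].
have mN : measurable N by exact: measurableU.
have mb := measurable_fun_mem mN.
split.
- rewrite (_ : [set x | _] = N)//.
  by apply/seteqP; split => x; rewrite /N/=; case: (f x) (g x) => [?|] [?|]//=;
    by [move=> [] | move=> _; left | move=> _; right].
- rewrite (_ : (fun x => _) = (fun x => if x \in N then 0 else
    complex.Re (odflt 0 (f x)) + complex.Re (odflt 0 (g x))))%R.
    by apply: measurable_fun_ifT => //; exact: measurable_funD.
  apply/funext => x; case: ifPn; rewrite ?inE ?notin_setE /N/=.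
    by case: (f x) (g x) => [?|] [?|]//= [].
  by case: (f x) (g x) => [[? ?]|] [[? ?]|]//=; tauto.
- rewrite (_ : (fun x => _) = (fun x => if x \in N then 0 else
    complex.Im (odflt 0 (f x)) + complex.Im (odflt 0 (g x))))%R.
    by apply: measurable_fun_ifT => //; exact: measurable_funD.
  apply/funext => x; case: ifPn; rewrite ?inE ?notin_setE /N/=.
    by case: (f x) (g x) => [?|] [?|]//= [].
  by case: (f x) (g x) => [[? ?]|] [[? ?]|]//=; tauto.
Qed.

End Measurability.

(** * Rearrangements and the Hardy-Littlewood-Polya principle *)

Section AlmostEverywhere.
Context (R : realType) d (T : measurableType d).
Variable mu : {measure set T -> \bar R}.

Lemma le_measure_ae (A B : set T) : measurable A -> measurable B ->
  {ae mu, forall x, A x -> B x} -> mu A <= mu B.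
Proof.
move=> mA mB /negligibleP; rewrite (_ : ~` _ = A `\` B); last first.
  by apply/seteqP; split => x/= /not_implyP.
move=> /(_ (measurableD mA mB)) AB0.
have := measureDI mu mA mB; rewrite AB0 add0e => ->.
by apply: le_measure; rewrite ?inE//; exact: measurableI.
Qed.

End AlmostEverywhere.

Section Monotone.
Context (R : realType).

(** A superlevel set of [F] is closed downwards, so it is a ray ending at its supremum [i], closed
    or open according to whether it contains [i]. *)
Lemma measurable_nincr_ereal (F : \bar R -> \bar R) :
  {homo F : x y / x <= y >-> y <= x} -> measurable_fun setT F.
Proof.
move=> Fni; apply: (measurability _ (ErealGenOInfty.measurableE R)).
move=> /= _ [_ [y ->] <-].
rewrite setTI.
set D := _ @^-1` _; have DF x : D x = (y%:E < F x) by rewrite /D/= in_itv/= andbT.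
have downD x z : D x -> z <= x -> D z.
  by rewrite !DF => Dx zx; exact: lt_le_trans (Fni _ _ zx).
pose i := ereal_sup D.
have ltD x : x < i -> D x.
  by move=> /ereal_sup_gt[z Dz xz]; exact: downD (ltW xz).
have leD x : D x -> x <= i by move=> Dx; exact: ereal_sup_ubound.
have [Di|Di] := pselect (D i).
  rewrite (_ : D = [set x | x <= i]); last first.
    by apply/seteqP; split => x//=; [exact: leD|exact: downD].
  by rewrite -(setTI (mkset _)); exact: emeasurable_fun_infty_c.
rewrite (_ : D = [set x | x < i]); last first.
  apply/seteqP; split => x/= => [Dx|/ltD//]; rewrite lt_neqAle leD// andbT.
  by apply: contra_notN Di => /eqP <-.
by rewrite -(setTI (mkset _)); exact: emeasurable_fun_infty_o.
Qed.

Lemma measurable_nincr (f : R -> \bar R) :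
  {homo f : x y / (x <= y)%R >-> y <= x} -> measurable_fun setT f.
Proof.
move=> fni.
(* The values at the infinite points extend [f] to a non-increasing function on the extended
   reals. *)
pose F (x : \bar R) := match x with r%:E => f r | +oo => -oo | -oo => +oo end.
rewrite (_ : f = F \o EFin)//; apply: measurableT_comp => //.
apply: measurable_nincr_ereal => -[x||] [y||]//=; rewrite ?leey ?leNye//.
by rewrite lee_fin; exact: fni.
Qed.

End Monotone.

Section Rearrangement.
Context (R : realType) d (T : measurableType d).
Variable mu : {measure set T -> \bar R}.
Implicit Types (f g : T -> ecomplex R) (t : R).

Definition dist f (s : \bar R) : \bar R := mu [set x | s < emod (f x)].

Lemma measurable_emod_gt f s : ecmeasurable f ->
  measurable [set x | s < emod (f x)].
Proof.
by move=> /measurable_emod mf; rewrite -(setTI (mkset _));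
  exact: emeasurable_fun_o_infty.
Qed.

Lemma measurable_emod_ge f s : ecmeasurable f ->
  measurable [set x | s <= emod (f x)].
Proof.
by move=> /measurable_emod mf; rewrite -(setTI (mkset _));
  exact: emeasurable_fun_c_infty.
Qed.

Lemma le_dist_ae f g s : ecmeasurable f -> ecmeasurable g ->
  {ae mu, forall x, emod (f x) <= emod (g x)} -> dist f s <= dist g s.
Proof.
move=> mf mg fg; apply: le_measure_ae; [exact: measurable_emod_gt..|].
by apply: filterS fg => x fgx /= sf; exact: lt_le_trans fgx.
Qed.

Lemma rearr_ge0 f t : 0 <= rearr mu f t.
Proof. by apply: le_ereal_inf_tmp => _ [s [s0 _] <-]; rewrite lee_fin. Qed.

(* The definition of [rearr] is not restricted to t >= 0: the infimum of the empty
   set gives a junk value on the negative half-line. *)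
Lemma rearr_neg f t : (t < 0)%R -> rearr mu f t = +oo.
Proof.
move=> t0; rewrite /rearr (_ : [set _ | _ in _] = set0) ?ereal_inf0//.
rewrite -subset0 => x [s [_ st] _]; move: st; apply/negP.
by rewrite -ltNge (@lt_le_trans _ _ 0)// lte_fin.
Qed.

Lemma rearr_nincr f : {homo rearr mu f : x y / (x <= y)%R >-> y <= x}.
Proof.
move=> t u tu; apply: ereal_inf_le_tmp => _ [s [s0 st] <-]; exists s => //.
by split => //; apply: le_trans st _; rewrite lee_fin.
Qed.

Lemma measurable_rearr f : measurable_fun setT (rearr mu f).
Proof. exact: measurable_nincr (@rearr_nincr f). Qed.

Lemma rearr_gt f t (s : R) : (0 <= s)%R -> s%:E < rearr mu f t ->
  t%:E < dist f s%:E.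
Proof.
move=> s0; rewrite !ltNge; apply: contra => st.
by apply: ereal_inf_lbound; exists s.
Qed.

(** A level [s < r] admissible in the infimum would give [mu {|f| > s} <= t], although that set
    contains [{|f| >= r}]. *)
Lemma rearr_ge f t (r : \bar R) : ecmeasurable f ->
  t%:E < mu [set x | r <= emod (f x)] -> r <= rearr mu f t.
Proof.
move=> mf tr; apply: le_ereal_inf_tmp => _ [s [_ st] <-].
rewrite leNgt; apply/negP => sr; move: (lt_le_trans tr (le_refl _)).
apply/negP; rewrite -leNgt; apply: le_trans st; apply: le_measure.
- by rewrite inE; exact: measurable_emod_ge.
- by rewrite inE; exact: measurable_emod_gt.
- by move=> x /=; exact: lt_le_trans.
Qed.

Lemma rearr_ge_dist f t (s : \bar R) : ecmeasurable f ->
  t%:E < dist f s -> s <= rearr mu f t.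
Proof.
move=> mf ts; apply: rearr_ge => //; apply: lt_le_trans ts _; apply: le_measure.
- by rewrite inE; exact: measurable_emod_gt.
- by rewrite inE; exact: measurable_emod_ge.
- by move=> x /= /ltW.
Qed.

Lemma rearr_dilate (c : R) f g t : (0 < c)%R -> ecmeasurable g ->
  (forall s : R, (0 < s)%R -> dist f s%:E <= c%:E * dist g s%:E) ->
  rearr mu f t <= rearr mu g (t / c).
Proof.
move=> c0 mg fg; apply: le_ereal_inf_tmp => _ [s [s0 st] <-].
(* The level [s] may be 0 while the hypothesis covers positive levels only, so [s] is raised by an
   arbitrary [e > 0]. *)
apply/lee_addgt0Pr => e e0; rewrite -EFinD.
apply: ereal_inf_lbound; exists (s + e)%R => //; split; first by rewrite addr_ge0// ltW.
apply: le_trans (fg _ _) _; first by rewrite ltr_wpDl.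
rewrite -lee_pdivlMl// -EFinM mulrC; apply: le_trans st; apply: le_measure.
- by rewrite inE; exact: measurable_emod_gt.
- by rewrite inE; exact: measurable_emod_gt.
- by move=> x /=; apply: le_lt_trans; rewrite lee_fin lerDl ltW.
Qed.

Lemma rearr_le_dist f g t : ecmeasurable g ->
  (forall s : R, (0 < s)%R -> dist f s%:E <= dist g s%:E) ->
  rearr mu f t <= rearr mu g t.
Proof.
move=> mg fg; rewrite -[X in rearr mu g X]divr1; apply: rearr_dilate => // s s0.
by rewrite mul1e; exact: fg.
Qed.

Lemma rearr_le_ae f g t : ecmeasurable f -> ecmeasurable g ->
  {ae mu, forall x, emod (f x) <= emod (g x)} ->
  rearr mu f t <= rearr mu g t.
Proof. by move=> mf mg fg; apply: rearr_le_dist => // s s0; exact: le_dist_ae. Qed.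

Lemma rearr_eq_ae f g : ecmeasurable f -> ecmeasurable g ->
  {ae mu, forall x, emod (f x) = emod (g x)} -> rearr mu f = rearr mu g.
Proof.
move=> mf mg fg; apply/funext => t; apply/eqP; rewrite eq_le.
by rewrite !rearr_le_ae//; apply: filterS fg => x ->.
Qed.

Let rearr_ecscale_le a f t : a != 0%R ->
  rearr mu (fun x => ecscale a (f x)) t <= emod (Some a) * rearr mu f t.
Proof.
move=> a0; set c := Normc.normc a; have c0 : (0 < c)%R by exact: normc_gt0.
rewrite emodE -lee_pdivrMl//; apply: le_ereal_inf_tmp => _ [s [s0 st] <-].
rewrite lee_pdivrMl// -EFinM; apply: ereal_inf_lbound; exists (c * s)%R => //.
split; first by rewrite mulr_ge0// ltW.
rewrite (_ : mkset _ = [set x | s%:E < emod (f x)])//.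
by apply/seteqP; split => x /=; rewrite emod_ecscale emodE EFinM lte_pmul2l// lte_fin.
Qed.

Lemma rearr_ecscale a f t : a != 0%R ->
  rearr mu (fun x => ecscale a (f x)) t = emod (Some a) * rearr mu f t.
Proof.
move=> a0; apply/eqP; rewrite eq_le rearr_ecscale_le//=.
(* The reverse inequality is the one already proved, for the factor [a^-1] and the function
   [a f]. *)
have := @rearr_ecscale_le (a^-1)%R (fun x => ecscale a (f x)) t.
rewrite invr_eq0 => /(_ a0).
rewrite (_ : (fun x => _) = f); last by apply/funext => x; rewrite ecscaleK.
rewrite !emodE Normc.normcV; set c := Normc.normc a.
have c0 : (0 < c)%R by exact: normc_gt0.
by rewrite lee_pdivlMl.
Qed.

Lemma rearr0 t : (0 <= t)%R -> rearr mu (fun=> Some 0%R) t = 0.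
Proof.
move=> t0; apply/eqP; rewrite eq_le rearr_ge0 andbT.
apply: ereal_inf_lbound; exists 0%R => //; split => //.
by rewrite (_ : mkset _ = set0) ?measure0// -subset0 => x; rewrite /mkset emod0 ltxx.
Qed.

End Rearrangement.

(** * Dilations of the line and Lebesgue measure *)

Section Dilation.
Context (R : realType).

(** The image of Lebesgue measure under division by [c], multiplied by [c^-1], gives every half-open
    interval its length, so by uniqueness it is Lebesgue measure. *)
Lemma lebesgue_measure_scale (c : R) (A : set (measurableTypeR R)) :
  (0 < c)%R -> measurable A ->
  lebesgue_measure ((fun x : R => x / c)%R @^-1` A) = c%:E * lebesgue_measure A.
Proof.
move=> c0 mA.
have c0' : (0 <= c^-1)%R by rewrite invr_ge0 ltW.
have mphi : measurable_fun setT
    (fun x : measurableTypeR R => (x / c)%R : measurableTypeR R).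
  exact: mulrr_measurable.
have /(_ mphi) -> : lebesgue_measure A = mscale (NngNum c0') (pushforward lebesgue_measure
    ((fun x => x / c)%R : measurableTypeR R -> measurableTypeR R)) A.
  move=> m; apply: lebesgue_measure_unique => //= _ [[a b]] _ <-.
  rewrite /mscale/= /pushforward.
  rewrite (_ : _ @^-1` _ = `](a * c)%R, (b * c)%R]%classic); last first.
    by apply/seteqP; split => x/=; rewrite !in_itv/= ltr_pdivlMr// ler_pdivrMr.
  rewrite !lebesgue_measure_itv/= !lte_fin ltr_pM2r//.
  case: ifPn => _; last by rewrite mule0.
  by rewrite -!EFinB -EFinM -mulrBl mulrC mulfK// gt_eqF.
by rewrite /mscale/= muleA -EFinM divff ?gt_eqF// mul1e.
Qed.

Lemma ge0_integral_dilate (c t : R) (phi : R -> \bar R) : (0 < c)%R ->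
  measurable_fun setT phi -> (forall x, 0 <= phi x) ->
  \int[lebesgue_measure]_(s in `[0%R, t]) phi (s / c)%R =
  c%:E * \int[lebesgue_measure]_(s in `[0%R, (t / c)%R]) phi s.
Proof.
move=> c0 mphi phi0.
have mdil : measurable_fun setT
    (fun x : measurableTypeR R => (x / c)%R : measurableTypeR R).
  exact: mulrr_measurable.
have := @ge0_integral_pushforward _ _ _ _ R _ mdil lebesgue_measure
  `[0%R, (t / c)%R] phi.
rewrite (_ : _ @^-1` _ = `[0%R, t]%classic); last first.
  apply/seteqP; split => x/=; rewrite !in_itv/= ?ler_pdivlMr ?ler_pdivrMr//;
  by rewrite mul0r ?divfK// gt_eqF.
move=> <-//; last exact: measurable_funTS.
have c0' : (0 <= c)%R by exact: ltW.
rewrite -(ge0_integral_mscale lebesgue_measure _ (NngNum c0'))//; last first.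
  exact: measurable_funTS.
by apply: eq_measure_integral => //= A mA _; exact: lebesgue_measure_scale.
Qed.

End Dilation.

(** * Norm inequalities from dominated distribution functions *)

Section HardyLittlewoodPolya.
Context (R : realType) d (T : measurableType d).
Variables (mu : {measure set T -> \bar R}) (N : functional R T).
Hypothesis normN : ri_quasi_Banach_norm mu N.
Hypothesis HLP_N : HLP_principle mu N.
Implicit Types (f g : T -> ecomplex R).

Lemma riq_eabs f : ecmeasurable f -> N (eabs f) = N f.
Proof. by have [[_ _ +] _ _ _ _ _] := normN; apply. Qed.

Lemma riq_ge0 f : ecmeasurable f -> 0 <= N f.
Proof. by have [[+ _ _] _ _ _ _ _] := normN; apply. Qed.

Lemma nonneg_eabs f : ecmeasurable f -> nonneg_fun mu (eabs f).
Proof.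
move=> mf; split; first exact: ecmeasurable_eabs.
by apply: aeW => x; rewrite /eabs emod_of_ereal// emod_ge0.
Qed.

Lemma emod_eabs f x : emod (eabs f x) = emod (f x).
Proof. by rewrite /eabs emod_of_ereal// emod_ge0. Qed.

Lemma eabs_ecscale a f :
  eabs (fun x => ecscale a (eabs f x)) = eabs (fun x => ecscale a (f x)).
Proof. by apply/funext => x; rewrite /eabs !emod_ecscale -/(eabs f x) emod_eabs. Qed.

(** Homogeneity is an axiom for non-negative functions only; passing to moduli, which leaves [N]
    unchanged, extends it. *)
Lemma riq_scale a f : ecmeasurable f ->
  N (fun x => ecscale a (f x)) = emod (Some a) * N f.
Proof.
move=> mf; rewrite -(riq_eabs mf).
have [_ [hs _ _] _ _ _ _] := normN; rewrite -hs; last exact: nonneg_eabs.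
rewrite -riq_eabs; last exact: ecmeasurable_ecscale.
rewrite -eabs_ecscale riq_eabs//.
exact/ecmeasurable_ecscale/ecmeasurable_eabs.
Qed.

Lemma riq_le_ae f g : ecmeasurable f -> ecmeasurable g ->
  {ae mu, forall x, emod (f x) <= emod (g x)} -> N f <= N g.
Proof.
move=> mf mg fg; rewrite -(riq_eabs mf) -(riq_eabs mg).
have [_ _ + _ _ _] := normN; apply; [exact: nonneg_eabs..|].
by apply: filterS fg => x; rewrite !emod_eabs.
Qed.

(** Homogeneity turns the goal into [N f <= N (c g)], to which the Hardy-Littlewood-Polya principle
    applies; this is its only direct application. *)
Lemma riq_dilate (c : R) f g : (1 <= c)%R -> ecmeasurable f -> ecmeasurable g ->
  (forall s : R, (0 < s)%R -> dist mu f s%:E <= c%:E * dist mu g s%:E) ->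
  N f <= c%:E * N g.
Proof.
move=> c1 mf mg fg; have c0 : (0 < c)%R by exact: lt_le_trans c1.
have nc : emod (Some (Complex c 0%R)) = c%:E by rewrite emod_real gtr0_norm.
have cn0 : Complex c 0%R != 0%R by rewrite eq_complex/= gt_eqF.
rewrite -nc -riq_scale//; apply: HLP_N => //; first exact: ecmeasurable_ecscale.
move=> t t0.
under [leRHS]eq_integral do rewrite rearr_ecscale// nc.
have mrg := measurable_rearr mu g.
have rg0 x := rearr_ge0 mu g x.
rewrite ge0_integralZl//; [|exact: measurable_funTS|by rewrite lee_fin ltW].
apply: (@le_trans _ _ (\int[lebesgue_measure]_(s in `[0%R, t]) rearr mu g (s / c)%R)).
  apply: ge0_le_integral => //.
  - by move=> x _; exact: rearr_ge0.
  - by apply: measurable_funTS; exact: measurable_rearr.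
  - apply: measurable_funTS.
    by apply: (measurableT_comp mrg); exact: mulrr_measurable.
  - by move=> x _; exact: rearr_dilate.
rewrite ge0_integral_dilate// lee_pmul2l//.
(* Since [c >= 1], the domain [[0, t/c]] left by the substitution lies in [[0, t]]. *)
apply: ge0_subset_integral => //; first exact: measurable_funTS.
apply: subset_itvl; rewrite bnd_simp ler_pdivrMr//.
by rewrite ler_peMr// ltW.
Qed.

End HardyLittlewoodPolya.

(** * Enumeration of the atoms *)

Section Atoms.
Context (R : realType) d (T : measurableType d).
Variables (mu : {measure set T -> \bar R}) (beta : R).
Hypothesis mu_sigma : sigma_finite setT mu.
Hypothesis beta_gt0 : (0 < beta)%R.
Hypothesis mu_atomic : completely_atomic mu.
Hypothesis mu_atoms : forall E : set T, is_atom mu E -> mu E = beta%:E.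

Lemma atom_subset (E : set T) : measurable E -> 0 < mu E ->
  exists F, [/\ F `<=` E, is_atom mu F & mu F = beta%:E].
Proof.
by move=> mE E0; have [F FE aF] := mu_atomic mE E0;
  exists F; split => //; exact: mu_atoms.
Qed.

Lemma measure_ge_beta (E : set T) : measurable E -> 0 < mu E -> beta%:E <= mu E.
Proof.
move=> mE E0; have [F [FE [mF _ _] <-]] := atom_subset mE E0.
by apply: le_measure; rewrite ?inE.
Qed.

Lemma atom_index_le (m n : nat) : (m <= n)%N ->
  atom_index mu beta n -> atom_index mu beta m.
Proof.
move=> mn; apply: le_trans.
by rewrite lee_fin ler_pM2r// ler_nat ltnS.
Qed.

(* A greedy enumeration: each new atom is taken in the first member of a
   sigma-finite exhaustion that is not yet exhausted, so that no positive
   mass can be left over for ever. *)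
Section Greedy.
Variable F : nat -> set T.
Hypothesis F_cover : [set: T] = \bigcup_i F i.
Hypothesis F_nd : nondecreasing_seq F.
Hypothesis F_fin : forall i, measurable (F i) /\ mu (F i) < +oo.

Let mF i : measurable (F i). Proof. exact: (F_fin i).1. Qed.

(** If every [F k] met [E] in a null set, [E] would be null, because the [F k] cover the space. *)
Let exhaust (E : set T) : measurable E -> 0 < mu E -> exists k, 0 < mu (F k `&` E).
Proof.
move=> mE; rewrite lt0e => /andP[+ _]; apply: contra_neqP => /forallNP FE0.
apply/eqP; rewrite -measure_le0 -[E]setTI F_cover setI_bigcupl.
apply: le_trans (measure_sigma_subadditive mu _ _ (@subset_refl _ _)) _.
- by move=> k; exact: measurableI.
- by apply: bigcup_measurable => k _; exact: measurableI.
rewrite eseries0// => k _ _; apply/eqP; rewrite -measure_le0 leNgt.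
exact/negP/FE0.
Qed.

(** An admissible next atom avoids the used part [S] and lies in every [F k] with mass left outside
    [S]; as the [F k] increase, it is enough to lie in the first of these. *)
Let good (S : set T) : set (set T) := [set E |
  [/\ is_atom mu E, E `<=` ~` S & forall k, 0 < mu (F k `\` S) -> E `<=` F k]].

Let next S : set T := xget set0 (good S).

Let used := fix used n : set T :=
  if n is m.+1 then used m `|` next (used m) else set0.

Let nextP S : measurable S -> 0 < mu (~` S) -> good S (next S).
Proof.
move=> mS S0; apply: xgetPex.
have := exhaust (measurableC mS) S0 => exk.
case: (ex_minnP exk) => k k0 kmin.
have [E [EF aE _]] := atom_subset (measurableD (mF k) mS) k0.
exists E; split => // [x /EF[]//|l /kmin kl x /EF[+ _]].
by move/subsetPset : (F_nd kl); apply.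
Qed.

Let measurable_next S : measurable (next S).
Proof.
have [exE|exE] := pselect (exists E, good S E).
  by have [[]] := xgetPex set0 exE.
rewrite /next xgetPN// => E gE.
by apply: exE; exists E.
Qed.

Let measurable_used n : measurable (used n).
Proof. by elim: n => //= n ih; exact: measurableU. Qed.

Let used_le m n : (m <= n)%N -> used m `<=` used n.
Proof.
move=> mn; rewrite -(subnK mn); elim: (n - m)%N => // k ih.
by move=> x /ih; left.
Qed.

Let measureTC (S : set T) : measurable S -> mu [set: T] = mu S + mu (~` S).
Proof.
by move=> mS; rewrite -(setUv S) measureU ?setICr//; exact: measurableC.
Qed.

Let unused_gt0 n : atom_index mu beta n -> mu (used n) = (n%:R * beta)%:E ->
  0 < mu (~` used n).
Proof.
move=> idx un; rewrite lt0e measure_ge0 andbT; apply/eqP => cn.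
(* The index condition asks for total mass at least [(n + 1) beta], whereas only [n beta] has been
   used. *)
move: idx; rewrite /atom_index (measureTC (measurable_used n)) un cn adde0 lee_fin.
by rewrite ler_pM2r// ler_nat ltnn.
Qed.

Let measure_usedS n : mu (used n) = (n%:R * beta)%:E ->
  is_atom mu (next (used n)) -> next (used n) `<=` ~` used n ->
  mu (used n.+1) = (n.+1%:R * beta)%:E.
Proof.
move=> un aE Eu.
have -> : mu (used n.+1) = mu (used n) + mu (next (used n)).
  by apply: measureU => //; rewrite -subset0 => x [xu /Eu].
by rewrite un (mu_atoms aE) -EFinD -natr1 mulrDl mul1r.
Qed.

Let used_good n : atom_index mu beta n ->
  mu (used n) = (n%:R * beta)%:E /\ good (used n) (next (used n)).
Proof.
elim: n => [|n ih] idx.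
  have u0 : mu (used 0%N) = (0%:R * beta)%:E by rewrite /= measure0 mul0r.
  by split => //; apply: nextP => //; exact: unused_gt0.
have [un [aE Eu _]] := ih (atom_index_le (leqnSn n) idx).
have u1 := measure_usedS un aE Eu.
by split => //; apply: nextP => //; exact: unused_gt0.
Qed.

Let usedE n x : used n x -> exists2 m, (m < n)%N & next (used m) x.
Proof.
elim: n => //= n ih [/ih[m mn xm]|xn]; last by exists n.
by exists m => //; exact: ltnW.
Qed.

Lemma greedy_atom_enumeration : atom_enumeration mu beta (next \o used).
Proof.
have em n : atom_index mu beta n -> is_atom mu (next (used n)).
  by move=> /used_good[_ []].
split => //.
  apply/trivIsetP => m n /= im + mn; wlog ltmn : m n im mn / (m < n)%N => [h|] in_.
    have [ltmn|ltnm] : (m < n)%N \/ (n < m)%N by case: ltngtP mn => //; [left|right].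
      exact: h.
    by rewrite setIC; apply: h => //; rewrite eq_sym.
  rewrite -subset0 => x [xm xn].
  have [_ [_ /(_ _ xn) + _]] := used_good in_; apply.
  by apply: (used_le ltmn); right.
set U := \bigcup_(n in _) _.
have mU : measurable U by apply: bigcup_measurable => n _ /=; exact: measurable_next.
(* If the remainder had positive mass, every index would be valid and infinitely many disjoint atoms
   would fall into one set of finite measure. *)
apply/eqP; rewrite -measure_le0 leNgt; apply/negP => C0.
have mC := measurableC mU.
have idx n : atom_index mu beta n.
  elim: n => [|n ih].
    rewrite /atom_index mul1r; apply: le_trans (measure_ge_beta mC C0) _.
    by apply: le_measure; rewrite ?inE.
  have idxn m : (m < n.+1)%N -> atom_index mu beta m.
    by move=> mn; apply: atom_index_le ih.
  have [un [aE Eu _]] := used_good ih.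
  have un1 := measure_usedS un aE Eu.
  (* The remainder has mass at least [beta] and lies outside [used n.+1], so the next index is valid
     too. *)
  rewrite /atom_index (measureTC (measurable_used n.+1)) un1.
  rewrite -natr1 mulrDl mul1r EFinD leeD2l//.
  apply: le_trans (measure_ge_beta mC C0) _; apply: le_measure; rewrite ?inE//.
    exact/measurableC/measurable_used.
  by apply: subsetC => x /usedE[m mn xm]; exists m => //; exact: idxn.
have [k k0] := exhaust mC C0.
(* [F k] keeps positive mass outside every [used n], so the greedy choice never leaves it. *)
have eF n : next (used n) `<=` F k.
  have [_ [_ _]] := used_good (idx n); apply; apply: lt_le_trans k0 _.
  apply: le_measure; rewrite ?inE; [exact: measurableI|exact: measurableD|].
  rewrite setDE; apply: setIS; apply: subsetC => x /usedE[m mn xm].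
  by exists m => //; exact: idx.
have uF n : mu (used n) <= mu (F k).
  by apply: le_measure; rewrite ?inE// => x /usedE[m _ /eF].
have := (F_fin k).2.
have Fk0 : 0 <= mu (F k) by [].
case: (mu (F k)) uF Fk0 => // r uF r0 _.
(* This many atoms inside [F k] have total mass greater than [r], the measure of [F k]. *)
have := uF (Num.truncn (r / beta)).+1.
rewrite (used_good (idx _)).1.
by rewrite lee_fin -ler_pdivlMr// leNgt truncnS_gt.
Qed.

End Greedy.

Lemma atomsP : atom_enumeration mu beta (atoms mu beta).
Proof.
rewrite /atoms; apply: xgetPex.
have /sigma_finiteP[F [FT Fnd Ffin]] := mu_sigma.
by eexists; exact: (greedy_atom_enumeration FT Fnd Ffin).
Qed.

Local Notation e := (atoms mu beta).

Lemma measurable_atoms n : atom_index mu beta n -> measurable (e n).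
Proof. by have [aE _ _] := atomsP => /aE[]. Qed.

Lemma measure_atoms n : atom_index mu beta n -> mu (e n) = beta%:E.
Proof. by have [aE _ _] := atomsP => /aE/mu_atoms. Qed.

(** Validity of the index [n.-1] implies that of all smaller ones. The case [n = 0] is separate,
    since [0.-1] is the index 0, which need not be valid. *)
Lemma measure_bigsetU_atoms n : (n = 0 \/ atom_index mu beta n.-1)%N ->
  mu (\big[setU/set0]_(i < n) e i) = (n%:R * beta)%:E.
Proof.
move=> idx; have idxi i : (i < n)%N -> atom_index mu beta i.
  case: idx => [->//|idx] ltin; apply: atom_index_le idx.
  by rewrite -ltnS prednK// (leq_trans _ ltin).
have [_ te _] := atomsP.
rewrite (measure_bigsetU_ord mu).
- transitivity (\sum_(i < n) beta%:E).
    by apply: eq_bigr => i _; exact/measure_atoms/idxi.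
  by rewrite sumEFin sumr_const card_ord mulr_natl.
- by move=> i; apply: measurable_atoms; exact: idxi.
- apply/trivIsetP => i j _ _ ij; move/trivIsetP : te; apply => //=; exact: idxi.
Qed.

End Atoms.

(** * Atom averages *)

Section AtomAverages.
Context (R : realType) d (T : measurableType d).
Variables (mu : {measure set T -> \bar R}) (beta : R).
Hypothesis mu_sigma : sigma_finite setT mu.
Hypothesis beta_gt0 : (0 < beta)%R.
Hypothesis mu_atomic : completely_atomic mu.
Hypothesis mu_atoms : forall E : set T, is_atom mu E -> mu E = beta%:E.

Local Notation e := (atoms mu beta).
Local Notation lam := (halfline R).
Local Notation idx := (atom_index mu beta).
Local Notation avg := (atom_average beta).
Implicit Types (f : T -> ecomplex R) (g : measurableTypeR R -> ecomplex R).

Let mE := measurable_atoms mu_sigma beta_gt0 mu_atomic mu_atoms.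

Lemma atom_average_ge0 g n : 0 <= avg g n.
Proof.
apply: mule_ge0; first by rewrite lee_fin invr_ge0 ltW.
by apply: integral_ge0 => x _; exact: rearr_ge0.
Qed.

Lemma atom_average_le g n : avg g n <= rearr lam g (n%:R * beta)%R.
Proof.
set r := rearr _ _ _.
rewrite /atom_average lee_pdivrMl//.
apply: (@le_trans _ _ (\int[lebesgue_measure]_(s in
    `[(n%:R * beta)%R, (n.+1%:R * beta)%R]) cst r s)).
  apply: ge0_le_integral => //.
  - by move=> x _; exact: rearr_ge0.
  - by apply: measurable_funTS; exact: measurable_rearr.
  - by move=> x /=; rewrite in_itv/= => /andP[nx _]; exact: rearr_nincr.
rewrite integral_cst//= lebesgue_measure_itv/= lte_fin ltr_pM2r// ltr_nat ltnSn.
by rewrite -EFinB -mulrBl -natr1 addrAC subrr add0r mul1r muleC.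
Qed.

(** [g^* >= r] holds on the first half of the n-th interval, whence half of [r] for the average. *)
Lemma atom_average_ge g n (r : R) : ecmeasurable g -> (0 <= r)%R ->
  ((n%:R + 2^-1) * beta)%:E <= dist lam g r%:E -> (r / 2)%:E <= avg g n.
Proof.
move=> mg r0 nr; rewrite /atom_average lee_pdivlMl//.
(* The interval is open on the right because [rearr_ge_dist] needs a strict inequality. *)
set I := `[(n%:R * beta)%R, ((n%:R + 2^-1) * beta)%R[%classic : set (measurableTypeR R).
have mI : measurable I by exact: measurable_itv.
apply: (@le_trans _ _ (\int[lebesgue_measure]_(s in I) cst r%:E s)).
  rewrite integral_cst//= /I lebesgue_measure_itv/= lte_fin ltr_pM2r// ltrDl.
  rewrite invr_gt0 ltr0n/= -EFinB -mulrBl addrAC subrr add0r -EFinM lee_fin.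
  by rewrite le_eqVlt; apply/orP; left; apply/eqP; ring.
apply: (@le_trans _ _ (\int[lebesgue_measure]_(s in I) rearr lam g s)).
  apply: ge0_le_integral => //.
  - by apply: measurable_funTS; exact: measurable_rearr.
  - move=> x; rewrite /I/= in_itv/= => /andP[_ xn]; apply: rearr_ge_dist => //.
    by apply: lt_le_trans nr; rewrite lte_fin.
apply: ge0_subset_integral => //.
- by apply: measurable_funTS; exact: measurable_rearr.
- by move=> x _; exact: rearr_ge0.
- move=> x; rewrite /I/= !in_itv/= => /andP[-> /= xn]; apply: (le_trans (ltW xn)).
  by rewrite ler_pM2r// -[n.+1%:R%R]natr1; lra.
Qed.

Definition tsum g (x : T) : \bar R :=
  \sum_(0 <= n <oo | idx n) avg g n * (\1_(e n) x)%:E.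

Lemma tildeE g x : tilde mu beta g x = of_ereal (tsum g x).
Proof. by []. Qed.

Let term_ge0 g x n : 0 <= avg g n * (\1_(e n) x)%:E.
Proof. by rewrite mule_ge0 ?atom_average_ge0// lee_fin. Qed.

Lemma tsum_ge0 g x : 0 <= tsum g x.
Proof. exact: nneseries_ge0. Qed.

Lemma measurable_tsum g : measurable_fun setT (tsum g).
Proof.
apply: (@ge0_emeasurable_sum _ _ _ setT (fun n x => avg g n * (\1_(e n) x)%:E) idx).
  by move=> *; exact: term_ge0.
move=> k idxk; apply: emeasurable_funM => //.
by apply/measurable_EFinP; apply: measurable_indic; exact: mE.
Qed.

Lemma ecmeasurable_tilde g : ecmeasurable (tilde mu beta g).
Proof. exact/ecmeasurable_of_ereal/measurable_tsum. Qed.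

Lemma emod_tilde g x : emod (tilde mu beta g x) = tsum g x.
Proof. by rewrite tildeE emod_of_ereal// tsum_ge0. Qed.

Lemma tsum_atom g n x : idx n -> e n x -> tsum g x = avg g n.
Proof.
move=> idxn xn; rewrite /tsum (nneseriesD1 (n := n))// eseries0.
  by rewrite adde0 indicE mem_set// mule1.
move=> k _ /= /andP[idxk kn]; rewrite indicE memNset ?mule0// => xk.
have [_ /trivIsetP te _] := atomsP mu_sigma beta_gt0 mu_atomic mu_atoms.
have := te k n idxk idxn kn; rewrite -subset0 => /(_ x); exact.
Qed.

Lemma tsum_gt g s x : 0 <= s -> s < tsum g x ->
  exists n, [/\ idx n, e n x & s < avg g n].
Proof.
move=> s0 sx; have [[n [idxn xn]]|nex] := pselect (exists n, idx n /\ e n x).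
  by exists n; split => //; rewrite -(tsum_atom g idxn xn).
move: sx; rewrite /tsum eseries0 ?ltNge ?s0// => n _ idxn.
by rewrite indicE memNset ?mule0// => xn; apply: nex; exists n.
Qed.

Let fin_of_le3 (x y : \bar R) : 0 <= y -> (y < +oo -> x <= 3%:E * y) -> x <= 3%:E * y.
Proof.
by case: y => [y||]// y0 h; [apply: h; rewrite ltry|rewrite gt0_muley ?leey// lte_fin].
Qed.

(** Let [M = mu {|f| > s}]. The set [{tilde g > s}] is covered by the atoms with [n beta < 2 M], of
    total mass at most [2 M + beta], and [beta <= M] unless [M = 0], when there are no such
    atoms. *)
Lemma dist_tilde_le f g (s : R) : ecmeasurable f -> (0 <= s)%R ->
  (forall t, s%:E < rearr lam g t -> (0 <= t)%R -> t%:E < 2%:E * dist mu f s%:E) ->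
  dist mu (tilde mu beta g) s%:E <= 3%:E * dist mu f s%:E.
Proof.
move=> mf s0 gf; apply: fin_of_le3 => // Mfin.
set M := dist mu f s%:E in gf Mfin *.
have nM x : s%:E < emod (tilde mu beta g x) ->
    exists n, [/\ idx n, e n x & (n%:R * beta)%:E < 2%:E * M].
  rewrite emod_tilde => /tsum_gt[|n [idxn xn sn]]; first by rewrite lee_fin.
  exists n; split => //; apply: gf; last by rewrite mulr_ge0// ltW.
  exact: lt_le_trans sn (atom_average_le _ _).
have M0 : 0 <= M by exact: measure_ge0.
have [M00|Mpos] := eqVneq M 0.
  rewrite M00 mule0 /dist (_ : mkset _ = set0) ?measure0// -subset0 => x.
  move=> /nM[n [_ _]]; rewrite M00 mule0 lte_fin ltNge mulr_ge0//.
  exact: ltW.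
have bM : beta%:E <= M.
  apply: (measure_ge_beta mu_atomic mu_atoms); first exact: measurable_emod_gt.
  by rewrite lt0e Mpos.
case: M Mfin nM M0 bM Mpos {gf} => // u _ nM _ bu _.
(* At invalid indices [e] is arbitrary and possibly not measurable, so it is replaced by the empty
   set. *)
pose e' n := if idx n then e n else set0.
have me' n : measurable (e' n) by rewrite /e'; case: ifPn => // /mE.
pose p := (Num.truncn (2 * u / beta)).+1.
apply: (@le_trans _ _ (mu (\big[setU/set0]_(i < p) e' i))).
  apply: le_measure; rewrite ?inE.
  - exact/measurable_emod_gt/ecmeasurable_tilde.
  - exact: bigsetU_measurable.
  - move=> x /= /nM[n [idxn xn nu]].
    have np : (n < p)%N.
      rewrite -(ltr_nat R); apply: (@lt_trans _ _ (2 * u / beta)%R).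
        by rewrite ltr_pdivlMr// -lte_fin EFinM.
      exact: truncnS_gt.
    rewrite -bigcup_mkord; exists n => //=.
    by rewrite /e' idxn.
apply: (@le_trans _ _ (\sum_(i < p) mu (e' i))); first exact: Boole_inequality.
apply: (@le_trans _ _ (\sum_(i < p) beta%:E)).
  apply: lee_sum => i _; rewrite /e'; case: ifPn => [idxi|_].
    by rewrite (measure_atoms mu_sigma beta_gt0 mu_atomic mu_atoms).
  by rewrite measure0 lee_fin ltW.
rewrite sumEFin sumr_const card_ord lee_fin.
rewrite -[X in (X <= _)%R]mulr_natl /p -natr1 mulrDl mul1r.
have -> : (3 * u = 2 * u + u)%R by ring.
apply: lerD; last by rewrite -lee_fin.
rewrite -ler_pdivlMr//; rewrite truncn_le divr_ge0 ?mulr_ge0 ?(ltW beta_gt0)//.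
by rewrite (le_trans (ltW beta_gt0))// -lee_fin.
Qed.

(* With M the measure of {|g| > s/2}, the average of g^* over the n-th atom is at
   least s/4 > s/5 as soon as (n + 1/2) beta <= M. *)
Lemma dist_tilde_ge f g (s : R) : ecmeasurable f -> ecmeasurable g -> (0 < s)%R ->
  dist mu f s%:E <= 2%:E * dist lam g (s / 2)%:E ->
  dist mu f s%:E <=
    3%:E * dist mu (fun x => ecscale (Complex 5%R 0%R) (tilde mu beta g x)) s%:E.
Proof.
move=> mf mg s0 fg.
set h := fun x => _; have mh : ecmeasurable h.
  by apply: ecmeasurable_ecscale; exact: ecmeasurable_tilde.
set m0 := dist mu f s%:E in fg *.
have m0T : m0 <= mu [set: T].
  by apply: le_measure; rewrite ?inE//; exact: measurable_emod_gt.
(* As [m0 <= 2 M], the average over the k-th atom is large once [(2k + 1) beta <= m0]; the index [m]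
   is valid once [(m + 1) beta <= m0]. For all [k <= m] both follow from [3 m beta < m0] if
   [m >= 1], and from [beta <= m0] if [m = 0]. *)
have step (m : nat) : (3 * m%:R * beta)%:E < m0 ->
    (m.+1%:R * beta)%:E <= dist mu h s%:E.
  move=> mm0.
  have bm0 : beta%:E <= m0.
    apply: (measure_ge_beta mu_atomic mu_atoms); first exact: measurable_emod_gt.
    by apply: le_lt_trans mm0; rewrite lee_fin !mulr_ge0// ltW.
  have lem0 (c : R) : (c <= Num.max 1 (3 * m%:R))%R -> (c * beta)%:E <= m0.
    rewrite le_max => /orP[c1|cm].
      by apply: le_trans bm0; rewrite lee_fin ger_pMl.
    by apply: le_trans (ltW mm0); rewrite lee_fin ler_pM2r.
  have m01 : (m = 0 \/ 1 <= m%:R :> R)%R.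
    by case: m {mm0 lem0} => [|m]; [left|right; rewrite ler1n].
  have idxm : idx m.
    apply: le_trans m0T; apply: lem0; rewrite le_max -natr1.
    by case: m01 => [->|m1]; [rewrite add0r lexx|apply/orP; right; lra].
  have avgm k : (k <= m)%N -> (s / 2 / 2)%:E <= avg g k.
    move=> km; apply: atom_average_ge => //; first by rewrite divr_ge0// ltW.
    rewrite -(@lee_pmul2l _ 2%:E)//; apply: le_trans fg.
    rewrite -EFinM mulrA; apply: lem0; rewrite le_max mulrDr mulfV//.
    have : (k%:R <= m%:R :> R)%R by rewrite ler_nat.
    by case: m01 => [->|m1] km'; apply/orP; [left|right]; lra.
  rewrite -(measure_bigsetU_atoms mu_sigma beta_gt0 mu_atomic mu_atoms); last by right.
  apply: le_measure; rewrite ?inE.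
  - by apply: bigsetU_measurable => k _; apply: mE; apply: atom_index_le idxm => //;
      rewrite -ltnS.
  - exact: measurable_emod_gt.
  - move=> x; rewrite -bigcup_mkord => -[k /= km xk].
    have idxk : idx k by apply: atom_index_le idxm.
    rewrite /h emod_ecscale emod_tilde (tsum_atom _ idxk xk) emod_real ger0_norm//.
    apply: (@lt_le_trans _ _ (5%:E * (s / 2 / 2)%:E)).
      by rewrite -EFinM lte_fin; lra.
    by rewrite lee_pmul2l// avgm.
apply: fin_of_le3 => // hfin.
have h0 : 0 <= dist mu h s%:E by exact: measure_ge0.
rewrite leNgt; apply/negP.
case: (dist mu h s%:E) step hfin h0 => // u step _ u0 um0.
have u0' : (0 <= u)%R by rewrite -lee_fin.
(* With [m] the integer part of [u / beta], [3 m beta <= 3 u < m0], and [step] gives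
   [(m + 1) beta <= u], contrary to the choice of [m]. *)
suff /step : (3 * (Num.truncn (u / beta))%:R * beta)%:E < m0.
  by rewrite leNgt lte_fin -ltr_pdivrMr// truncnS_gt.
apply: le_lt_trans um0.
rewrite -EFinM lee_fin -mulrA ler_pM2l// -ler_pdivlMr// truncn_le.
by rewrite divr_ge0// ltW.
Qed.

End AtomAverages.

(** * Sums of spaces and splittings *)

Section HalfLine.
Context (R : realType).
Local Notation lam := (halfline R).

(** [E] contains the part of [[0, +oo[] below [M]; its points on the negative axis do not count for
    the half-line measure. *)
Lemma halfline_ge (M : \bar R) (E : set (measurableTypeR R)) :
  measurable E -> (forall t : R, (0 <= t)%R -> t%:E < M -> E t) -> M <= lam E.
Proof.
move=> mE; rewrite /= /mrestr; case: M => [r||] h; last by rewrite leNye.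
- have [r0|r0] := leP r 0%R.
    by apply: (@le_trans _ _ 0); rewrite ?lee_fin// measure_ge0.
  rewrite [leLHS](_ : _ = lebesgue_measure `[0%R, r[%classic); last first.
    by rewrite lebesgue_measure_itv/= lte_fin r0 oppr0 addr0.
  apply: le_measure; rewrite ?inE//; first exact: measurableI.
  by move=> t /=; rewrite !in_itv/= => /andP[t0 tr]; split; [apply: h|rewrite t0].
- rewrite [leLHS](_ : _ = lebesgue_measure `[0%R, +oo[%classic); last first.
    by rewrite lebesgue_measure_itv/= ltry.
  apply: le_measure; rewrite ?inE//; first exact: measurableI.
  by move=> t /=; rewrite !in_itv/= andbT => t0; split => //;
    apply: h => //; rewrite ltry.
Qed.

Lemma halfline_le (M : \bar R) (E : set (measurableTypeR R)) : 0 <= M ->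
  measurable E -> (forall t : R, (0 <= t)%R -> E t -> t%:E < M) -> lam E <= M.
Proof.
move=> M0 mE; rewrite /= /mrestr; case: M M0 => [r||]// r0 h; last by rewrite leey.
rewrite [leRHS](_ : _ = lebesgue_measure `[0%R, r[%classic); last first.
  rewrite lebesgue_measure_itv/= lte_fin; case: ltP => [_|]; first by rewrite oppr0 addr0.
  by rewrite -lee_fin => r0'; apply/eqP; rewrite eq_le r0 r0'.
apply: le_measure; rewrite ?inE//; first exact: measurableI.
move=> t [Et]; rewrite /= !in_itv/= andbT => t0; rewrite t0/=.
by rewrite -lte_fin; exact: h.
Qed.

End HalfLine.

(** The infimum is taken in one variable at a time; moving the other term across requires it to be
    finite, so infinite values are treated first. *)
Lemma lee_ereal_infD (R : realType) (S1 S2 : set (\bar R)) (y : \bar R) :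
  (forall a, S1 a -> 0 <= a) -> (forall b, S2 b -> 0 <= b) ->
  (forall a b, S1 a -> S2 b -> y <= a + b) -> y <= ereal_inf S1 + ereal_inf S2.
Proof.
move=> S1_0 S2_0 yS.
have i1_0 : 0 <= ereal_inf S1 by exact: le_ereal_inf_tmp.
have i2_0 : 0 <= ereal_inf S2 by exact: le_ereal_inf_tmp.
have yi b : S2 b -> y <= ereal_inf S1 + b.
  move=> S2b; have [->|bfin] := eqVneq b +oo.
    by rewrite addey ?leey// gt_eqF// (lt_le_trans _ i1_0).
  have {}bfin : b \is a fin_num by rewrite ge0_fin_numE ?S2_0// lt_neqAle bfin leey.
  by rewrite -leeBlDr//; apply: le_ereal_inf_tmp => a S1a; rewrite leeBlDr//; exact: yS.
have [->|fin1] := eqVneq (ereal_inf S1) +oo.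
  by rewrite addye ?leey// gt_eqF// (lt_le_trans _ i2_0).
have {}fin1 : ereal_inf S1 \is a fin_num by rewrite ge0_fin_numE// lt_neqAle fin1 leey.
rewrite addeC -leeBlDr//; apply: le_ereal_inf_tmp => b S2b.
by rewrite leeBlDr// addeC; exact: yi.
Qed.

(** * From domination by a sum to an exact decomposition *)

Section SumOfSpaces.
Context (R : realType) d (T : measurableType d).
Variables (mu : {measure set T -> \bar R}) (NA NB : functional R T).
Hypothesis NA_mono : forall f g, ecmeasurable f -> ecmeasurable g ->
  {ae mu, forall x, emod (f x) <= emod (g x)} -> NA f <= NA g.
Hypothesis NB_mono : forall f g, ecmeasurable f -> ecmeasurable g ->
  {ae mu, forall x, emod (f x) <= emod (g x)} -> NB f <= NB g.

(** The maximum with 0 absorbs the value [+oo - +oo = -oo], which arises when [u] and [a] are both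
    infinite. *)
Let excess_le (u a b : \bar R) : 0 <= a -> 0 <= b -> u <= a + b ->
  maxe 0 (u - mine u a) <= b.
Proof.
move=> a0 b0 uab; rewrite ge_max b0/=; have [ua|au] := leP u a.
  by case: u {ua uab} => [u||]; [rewrite subee|rewrite leNye|rewrite leNye].
have afin : a \is a fin_num by rewrite ge0_fin_numE// (lt_le_trans au)// leey.
by rewrite leeBlDr// addeC.
Qed.

Let excess_eq (u a : \bar R) : 0 <= u -> 0 <= a ->
  mine u a + maxe 0 (u - mine u a) = u.
Proof.
move=> u0 a0; have [ua|au] := leP u a.
  by case: u u0 {ua} => [u||]// _; rewrite ?subee ?maxxx ?adde0.
have afin : a \is a fin_num by rewrite ge0_fin_numE// (lt_le_trans au)// leey.
by rewrite max_r ?sube_ge0 ?ltW ?afin// addeC subeK.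
Qed.

(** [sum_norm] asks for an exact decomposition. Cutting [|fA|] at [u] and giving the rest of [u] to
    the second part produces one, with parts dominated by [|fA|] and [|fB|] respectively. *)
Lemma sum_norm_le_ae (u : T -> \bar R) fA fB : measurable_fun setT u ->
  (forall x, 0 <= u x) -> Defs.space NA fA -> Defs.space NB fB ->
  {ae mu, forall x, u x <= emod (fA x) + emod (fB x)} ->
  sum_norm mu NA NB (fun x => of_ereal (u x)) <= NA fA + NB fB.
Proof.
move=> mmu u0 [mA finA] [mB finB] uAB.
pose hA x := mine (u x) (emod (fA x)); pose hB x := maxe 0 (u x - hA x).
have hA0 x : 0 <= hA x by rewrite /hA le_min u0 emod_ge0.
have hB0 x : 0 <= hB x by rewrite /hB le_max lexx.
have mhA : measurable_fun setT hA by apply: measurable_mine => //; exact: measurable_emod.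
have mhB : measurable_fun setT hB.
  by apply: measurable_maxe => //; exact: emeasurable_funB.
have leA : NA (fun x => of_ereal (hA x)) <= NA fA.
  apply: NA_mono => //; first exact: ecmeasurable_of_ereal.
  by apply: aeW => x; rewrite emod_of_ereal// /hA ge_min lexx orbT.
have leB : NB (fun x => of_ereal (hB x)) <= NB fB.
  apply: NB_mono => //; first exact: ecmeasurable_of_ereal.
  by apply: filterS uAB => x uAB; rewrite emod_of_ereal//; apply: excess_le => //;
    exact: emod_ge0.
apply: le_trans (leeD leA leB); apply: ereal_inf_lbound.
exists (fun x => of_ereal (hA x)), (fun x => of_ereal (hB x)); split => //.
- by split; [exact: ecmeasurable_of_ereal|exact: le_lt_trans finA].
- by split; [exact: ecmeasurable_of_ereal|exact: le_lt_trans finB].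
- apply: aeW => x; rewrite ecadd_of_ereal//; congr of_ereal.
  by rewrite excess_eq// emod_ge0.
Qed.

End SumOfSpaces.

(** * Splitting a function according to its levels *)

Section LevelSplitting.
Context (R : realType) d (T : measurableType d).
Variable mu : {measure set T -> \bar R}.
Local Notation lam := (halfline R).
Implicit Types (f : T -> ecomplex R) (g : measurableTypeR R -> ecomplex R).

(* The infimum of the values of |f| on the set need not be attained, so the set is
   exhausted from above by the sets {|f| >= r} with r in V. *)
Lemma measure_level_le f (V : set (\bar R)) (s M : \bar R) : ecmeasurable f ->
  measurable [set x | V (emod (f x))] -> 0 <= M ->
  (forall r, V r -> s < r -> mu [set x | r <= emod (f x)] <= M) ->
  mu [set x | V (emod (f x)) /\ s < emod (f x)] <= M.
Proof.
move=> mf mV M0 VM; set E := mkset _.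
have mE : measurable E by apply: measurableI => //; exact: measurable_emod_gt.
pose i := ereal_inf [set emod (f x) | x in E].
have Ei x : E x -> i <= emod (f x) by move=> Ex; apply: ereal_inf_lbound; exists x.
have Er x : E x -> mu [set y | emod (f x) <= emod (f y)] <= M.
  by move=> [Vx sx]; exact: VM.
(* If the infimum [i] is attained in [E], then [E] lies in [{|f| >= i}], where the hypothesis
   applies. *)
have [[x [Ex xi]]|nai] := pselect (exists x, E x /\ emod (f x) = i).
  apply: le_trans (Er x Ex); apply: le_measure; rewrite ?inE//.
    exact: measurable_emod_ge.
  by move=> y /Ei; rewrite /= xi.
have {nai}Ei' x : E x -> i < emod (f x).
  move=> Ex; rewrite lt_neqAle Ei// andbT; apply/eqP => ix.
  by apply: nai; exists x.
have [->|/set0P[x0 Ex0]] := eqVneq E set0; first by rewrite measure0.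
have iy : i < +oo by rewrite (lt_le_trans (Ei' _ Ex0))// leey.
have i0 : 0 <= i by apply: le_ereal_inf_tmp => _ [x _ <-]; exact: emod_ge0.
have ifin : i \is a fin_num by rewrite ge0_fin_numE.
pose Ek k := E `&` [set x | i + (k.+1%:R^-1)%:E <= emod (f x)].
have mEk k : measurable (Ek k) by apply: measurableI => //; exact: measurable_emod_ge.
have EkE : \bigcup_k Ek k = E.
  apply/seteqP; split => [x [k _ []]//|x Ex].
  have ix := Ei' _ Ex; move: ix; rewrite -(fineK ifin).
  case fx : (emod (f x)) => [v||]//; last first.
    by move=> _; exists 0%N => //; split => //=; rewrite fx leey.
  rewrite lte_fin -subr_gt0 => iv.
  exists (Num.truncn (v - fine i)^-1) => //; split => //=.
  rewrite fx -(fineK ifin) -EFinD lee_fin -lerBrDl.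
  rewrite -[leRHS]invrK lef_pV2 ?posrE ?invr_gt0//.
  by rewrite ltW// truncnS_gt.
(* Some [x] in [E] has [|f(x)| < i + 1/(k+1)], and [Ek k] lies in [{|f| >= |f(x)|}]. *)
have Ekle k : mu (Ek k) <= M.
  have : i < i + (k.+1%:R^-1)%:E by rewrite lteDl// lte_fin invr_gt0.
  move=> /ereal_inf_lt[_ [x Ex <-] xk].
  apply: le_trans (Er x Ex); apply: le_measure; rewrite ?inE//.
    exact: measurable_emod_ge.
  by move=> y [_ /=]; apply: le_trans; exact: ltW.
have ndE : nondecreasing_seq Ek.
  move=> k l kl; apply/subsetPset; apply: setIS => x /=; apply: le_trans.
  by rewrite leeD2l// lee_fin lef_pV2 ?posrE// ler_nat.
have mU : measurable (\bigcup_k Ek k) by rewrite EkE.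
have cE := nondecreasing_cvg_mu (mu := mu) mEk mU ndE.
rewrite -EkE -(cvg_lim _ cE)//; apply: lime_le.
  by apply/cvg_ex; eexists; exact: cE.
exact: nearW.
Qed.

Let le_half_max (x a b : \bar R) : x <= a + b -> x <= 2%:E * a \/ x <= 2%:E * b.
Proof.
move=> xab; have tw (c : \bar R) : c + c = 2%:E * c.
  by rewrite -mule2n -mule_natl.
have [ab|/ltW ba] := leP a b; [right|left];
  by rewrite -tw; apply: le_trans xab _; rewrite ?leeD2l ?leeD2r.
Qed.

Lemma dist_split f gA gB : ecmeasurable f -> ecmeasurable gA -> ecmeasurable gB ->
  {ae lam, forall t : measurableTypeR R, rearr mu f t <= emod (gA t) + emod (gB t)} ->
  exists2 D : set T, measurable D & forall s : R, (0 <= s)%R ->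
    dist mu (fun x => if x \in D then f x else Some 0%R) s%:E <=
      2%:E * dist lam gA (s / 2)%:E /\
    dist mu (fun x => if x \in ~` D then f x else Some 0%R) s%:E <=
      2%:E * dist lam gB (s / 2)%:E.
Proof.
move=> mf mA mB fAB.
pose F r := mu [set x | r <= emod (f x)].
pose H (g : measurableTypeR R -> ecomplex R) r :=
  lam [set t | r * 2^-1%:E <= emod (g t)].
have half_le (r r' : \bar R) : r <= r' -> r * 2^-1%:E <= r' * 2^-1%:E.
  by move=> rr'; rewrite lee_wpmul2r// lee_fin.
have mH g r : ecmeasurable g -> measurable [set t | r * 2^-1%:E <= emod (g t)].
  by move=> mg; exact: measurable_emod_ge.
(* The set [{f^* >= r}] contains [[0, F r[], and at almost every point of it [|gA|] or [|gB|] is at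
   least [r/2]. *)
have FAB r : F r <= H gA r + H gB r.
  have mr : measurable [set t | r <= rearr mu f t].
    rewrite -(setTI (mkset _)); apply: emeasurable_fun_c_infty => //.
    exact: measurable_rearr.
  apply: (@le_trans _ _ (lam [set t | r <= rearr mu f t])).
    by apply: halfline_ge => // t t0; exact: rearr_ge.
  apply: le_trans (measureU2 (halfline R) (mH gA r mA) (mH gB r mB)).
  apply: le_measure_ae => //; first by apply: measurableU; exact: mH.
  apply: (@filterS _ _ (ae_filter_ringOfSetsType lam)) fAB => t fAB /= rt.
  by have [h|h] := le_half_max (le_trans rt fAB); [left|right];
    rewrite /= muleC lee_pdivrMl.
(* Monotonicity of [F] and [H gA] in the level makes [D] measurable. *)
have mF : measurable_fun setT F.
  apply: measurable_nincr_ereal => r r' rr'; apply: le_measure; rewrite ?inE.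
  - exact: measurable_emod_ge.
  - exact: measurable_emod_ge.
  - by move=> x /=; exact: le_trans.
have mHA : measurable_fun setT (H gA).
  apply: measurable_nincr_ereal => r r' rr'.
  apply: le_measure; rewrite ?inE; [exact: mH..|].
  by move=> x /=; apply: le_trans; exact: half_le.
(* [V] collects the levels at which the alternative with [gA] holds; outside [V] the one with [gB]
   does. *)
pose V := [set r | F r <= 2%:E * H gA r].
pose D := [set x | V (emod (f x))].
have mD : measurable D.
  rewrite -(setTI D); apply: measurable_lee => //.
    by apply: measurableT_comp => //; exact: measurable_emod.
  apply: emeasurable_funM => //; apply: measurableT_comp => //.
  exact: measurable_emod.
exists D => // s s0.
(* Since [s < r], the set [{|g| >= r/2}] lies in [{|g| > s/2}]. *)
have HM g r : ecmeasurable g -> s%:E < r -> F r <= 2%:E * H g r ->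
    F r <= 2%:E * dist lam g (s / 2)%:E.
  move=> mg sr /le_trans; apply; rewrite lee_pmul2l//.
  apply: le_measure; rewrite ?inE; [exact: mH|exact: measurable_emod_gt|].
  move=> t /=; apply: lt_le_trans.
  by rewrite EFinM lte_pmul2r// lte_fin.
split.
- rewrite /dist (_ : mkset _ = [set x | V (emod (f x)) /\ s%:E < emod (f x)]).
    apply: measure_level_le => //.
    by move=> r Vr sr; apply: HM.
  apply/seteqP; split => x /=.
    case: ifPn; first by rewrite inE.
    by rewrite emod0 lte_fin ltNge s0.
  by move=> [Vx sx]; rewrite mem_set.
- rewrite /dist (_ : mkset _ = [set x | (~` V) (emod (f x)) /\ s%:E < emod (f x)]).
    apply: measure_level_le => //; first exact: measurableC.
    by move=> r Vr sr; apply: HM => //; case: (le_half_max (FAB r)).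
  apply/seteqP; split => x /=.
    case: ifPn; first by rewrite inE.
    by rewrite emod0 lte_fin ltNge s0.
  by move=> [Vx sx]; rewrite mem_set.
Qed.

Lemma dist_ecadd_le f fA fB (a b : R) :
  ecmeasurable f -> ecmeasurable fA -> ecmeasurable fB ->
  {ae mu, forall x, f x = ecadd (fA x) (fB x)} ->
  dist mu f (a + b)%:E <= dist mu fA a%:E + dist mu fB b%:E.
Proof.
move=> mf mA mB fAB.
have mAa := measurable_emod_gt a%:E mA; have mBb := measurable_emod_gt b%:E mB.
apply: le_trans (measureU2 mu mAa mBb).
apply: le_measure_ae; [exact: measurable_emod_gt|exact: measurableU|].
apply: filterS fAB => x fx /=; rewrite fx => abx.
have [xa|xa] := ltP a%:E (emod (fA x)); first by left.
have [xb|xb] := ltP b%:E (emod (fB x)); first by right.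
move: abx; rewrite ltNge EFinD => /negP[].
by apply: le_trans (emod_ecadd _ _) _; rewrite leeD.
Qed.

(** Levels admissible for [fA] and [fB] at [t/2] add up to a level admissible for [f] at [t]. *)
Lemma rearr_ecadd_le f fA fB (t : R) :
  ecmeasurable f -> ecmeasurable fA -> ecmeasurable fB ->
  {ae mu, forall x, f x = ecadd (fA x) (fB x)} ->
  rearr mu f t <= rearr mu fA (t / 2) + rearr mu fB (t / 2).
Proof.
move=> mf mA mB fAB.
apply: lee_ereal_infD => [_ [s [s0 _] <-]|_ [s [s0 _] <-]|]; rewrite ?lee_fin//.
move=> _ _ [a [a0 ha] <-] [b [b0 hb] <-].
apply: ereal_inf_lbound; exists (a + b)%R => //; split; first exact: addr_ge0.
rewrite [t%:E](_ : _ = (t / 2)%:E + (t / 2)%:E); last by rewrite -EFinD -splitr.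
by apply: le_trans (leeD ha hb); exact: dist_ecadd_le.
Qed.

End LevelSplitting.

(** * The norm of the sum of the canonical spaces *)

Section Functionals.
Context (R : realType) d (T : measurableType d).
Variable mu : {measure set T -> \bar R}.
Implicit Types (f g : T -> ecomplex R) (N NA NB : functional R T).

(** The axiom covers non-negative functions; the lattice property and [|f + g| <= |f| + |g|] carry
    it over to all measurable ones. *)
Lemma riq_triangle N : ri_quasi_Banach_norm mu N -> exists K : R, (1 <= K)%R /\
  forall f g, ecmeasurable f -> ecmeasurable g ->
    N (fun x => ecadd (f x) (g x)) <= K%:E * (N f + N g).
Proof.
move=> nN; have [_ [_ _ [K [K1 NK]]] _ _ _ _] := nN; exists K; split => // f g mf mg.
rewrite -(riq_eabs nN mf) -(riq_eabs nN mg).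
apply: le_trans (NK _ _ (nonneg_eabs mu mf) (nonneg_eabs mu mg)).
apply: (riq_le_ae nN); [exact: ecmeasurable_ecadd|..].
  by apply: ecmeasurable_ecadd; exact: ecmeasurable_eabs.
apply: aeW => x; apply: le_trans (emod_ecadd _ _) _.
by rewrite ecadd_of_ereal ?emod_ge0// emod_of_ereal// adde_ge0// emod_ge0.
Qed.

Lemma sum_norm_ge0 NA NB f : (forall g, ecmeasurable g -> 0 <= NA g) ->
  (forall g, ecmeasurable g -> 0 <= NB g) -> 0 <= sum_norm mu NA NB f.
Proof.
move=> NA0 NB0; apply: le_ereal_inf_tmp => _ [fA [fB [[mA _] [mB _] _ ->]]].
by rewrite adde_ge0 ?NA0 ?NB0.
Qed.

Lemma sum_norm_triangle NA NB (K : R) f g : (1 <= K)%R ->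
  (forall h, ecmeasurable h -> 0 <= NA h) -> (forall h, ecmeasurable h -> 0 <= NB h) ->
  (forall h k, ecmeasurable h -> ecmeasurable k ->
    NA (fun x => ecadd (h x) (k x)) <= K%:E * (NA h + NA k)) ->
  (forall h k, ecmeasurable h -> ecmeasurable k ->
    NB (fun x => ecadd (h x) (k x)) <= K%:E * (NB h + NB k)) ->
  sum_norm mu NA NB (fun x => ecadd (f x) (g x)) <=
    K%:E * (sum_norm mu NA NB f + sum_norm mu NA NB g).
Proof.
move=> K1 NA0 NB0 NAK NBK; have K0 : (0 < K)%R by exact: lt_le_trans K1.
rewrite -lee_pdivrMl//; apply: lee_ereal_infD.
- by move=> _ [fA [fB [[mA _] [mB _] _ ->]]]; rewrite adde_ge0 ?NA0 ?NB0.
- by move=> _ [fA [fB [[mA _] [mB _] _ ->]]]; rewrite adde_ge0 ?NA0 ?NB0.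
move=> r1 r2 [fA [fB [[mfA finfA] [mfB finfB] fAB ->]]].
move=> [gA [gB [[mgA fingA] [mgB fingB] gAB ->]]].
rewrite lee_pdivrMl//.
have leA := NAK _ _ mfA mgA; have leB := NBK _ _ mfB mgB.
have fin (x y z : \bar R) : 0 <= x -> 0 <= y -> z <= K%:E * (x + y) ->
    x < +oo -> y < +oo -> z < +oo.
  move=> x0 y0 /le_lt_trans + xfin yfin; apply.
  by rewrite lte_mul_pinfty ?lte_add_pinfty// lee_fin ltW.
rewrite addeACA muleDr ?ge0_adde_def// ?inE ?adde_ge0 ?NA0 ?NB0//.
apply: le_trans (leeD leA leB); apply: ereal_inf_lbound.
exists (fun x => ecadd (fA x) (gA x)), (fun x => ecadd (fB x) (gB x)); split => //.
- split; first exact: ecmeasurable_ecadd.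
  by apply: fin leA _ _ => //; exact: NA0.
- split; first exact: ecmeasurable_ecadd.
  by apply: fin leB _ _ => //; exact: NB0.
- apply: filterS2 fAB gAB => x -> ->.
  by rewrite -!ecaddA; congr ecadd; rewrite !ecaddA; congr ecadd; exact: ecaddC.
Qed.

Let sum_norm_ecscale_le NA NB a f : a != 0%R ->
  (forall h, ecmeasurable h -> 0 <= NA h) -> (forall h, ecmeasurable h -> 0 <= NB h) ->
  (forall h, ecmeasurable h -> NA (fun x => ecscale a (h x)) = emod (Some a) * NA h) ->
  (forall h, ecmeasurable h -> NB (fun x => ecscale a (h x)) = emod (Some a) * NB h) ->
  sum_norm mu NA NB (fun x => ecscale a (f x)) <= emod (Some a) * sum_norm mu NA NB f.
Proof.
move=> a0 NA0 NB0 NAa NBa.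
set c := Normc.normc a; have c0 : (0 < c)%R by exact: normc_gt0.
rewrite emodE -lee_pdivrMl//; apply: le_ereal_inf_tmp.
move=> _ [fA [fB [[mA finA] [mB finB] fAB ->]]]; rewrite lee_pdivrMl//.
rewrite muleDr ?ge0_adde_def// ?inE ?NA0 ?NB0// -/c -emodE -NAa// -NBa//.
apply: ereal_inf_lbound.
exists (fun x => ecscale a (fA x)), (fun x => ecscale a (fB x)); split => //.
- split; first exact: ecmeasurable_ecscale.
  by rewrite NAa// emodE lte_mul_pinfty ?lee_fin// ltW.
- split; first exact: ecmeasurable_ecscale.
  by rewrite NBa// emodE lte_mul_pinfty ?lee_fin// ltW.
- by apply: filterS fAB => x ->; rewrite ecscaleD.
Qed.

Lemma sum_norm_ecscale NA NB a f : a != 0%R ->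
  (forall h, ecmeasurable h -> 0 <= NA h) -> (forall h, ecmeasurable h -> 0 <= NB h) ->
  (forall b h, b != 0%R -> ecmeasurable h ->
    NA (fun x => ecscale b (h x)) = emod (Some b) * NA h) ->
  (forall b h, b != 0%R -> ecmeasurable h ->
    NB (fun x => ecscale b (h x)) = emod (Some b) * NB h) ->
  sum_norm mu NA NB (fun x => ecscale a (f x)) = emod (Some a) * sum_norm mu NA NB f.
Proof.
move=> a0 NA0 NB0 NAs NBs; apply/eqP; rewrite eq_le.
apply/andP; split.
  by apply: sum_norm_ecscale_le => // h; [exact: NAs|exact: NBs].
have ai0 : (a^-1 != 0)%R by rewrite invr_eq0.
have := @sum_norm_ecscale_le NA NB (a^-1)%R (fun x => ecscale a (f x)) ai0 NA0 NB0
  (fun h => NAs _ h ai0) (fun h => NBs _ h ai0).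
rewrite (_ : (fun x => _) = f); last by apply/funext => x; rewrite ecscaleK.
rewrite !emodE Normc.normcV; set c := Normc.normc a.
have c0 : (0 < c)%R by exact: normc_gt0.
by rewrite lee_pdivlMl.
Qed.

Lemma local_L1_le N1 N2 (K : R) : (0 < K)%R ->
  (forall f, ecmeasurable f -> 0 <= N1 f) ->
  (forall f, ecmeasurable f -> N1 f <= K%:E * N2 f) ->
  local_L1 mu N1 -> local_L1 mu N2.
Proof.
move=> K0 N10 N12 L1 E mE Efin; have [C hC] := L1 E mE Efin.
(* The absolute value covers a negative [C], for which multiplication would reverse the
   inequality. *)
exists (`|C| * K)%R => f nf; have [mf _] := nf.
apply: le_trans (hC f nf) _; apply: (@le_trans _ _ (`|C|%:E * N1 f)).
  by apply: lee_wpmul2r; [exact: N10|rewrite lee_fin ler_norm].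
by rewrite EFinM -muleA; apply: lee_wpmul2l; [rewrite lee_fin|exact: N12].
Qed.

End Functionals.

(** * Comparison of the two sum norms and its consequences *)

Section CanonicalSum.
Context (R : realType) d (T : measurableType d).
Variables (mu : {measure set T -> \bar R}) (beta : R).
Hypothesis mu_sigma : sigma_finite setT mu.
Hypothesis beta_gt0 : (0 < beta)%R.
Hypothesis mu_atomic : completely_atomic mu.
Hypothesis mu_atoms : forall E : set T, is_atom mu E -> mu E = beta%:E.
Local Notation lam := (halfline R).
Implicit Types (f : T -> ecomplex R) (g : measurableTypeR R -> ecomplex R).

Let mtilde g : ecmeasurable (tilde mu beta g).
Proof. exact: ecmeasurable_tilde. Qed.

Lemma ecmeasurable_half_rearr f :
  ecmeasurable (fun t : measurableTypeR R => of_ereal (rearr mu f (t / 2)%R)).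
Proof.
apply: ecmeasurable_of_ereal; apply: (measurableT_comp (measurable_rearr mu f)).
exact: mulrr_measurable.
Qed.

Section OneNorm.
Variable N : functional R T.
Hypothesis normN : ri_quasi_Banach_norm mu N.

Lemma canonical_ge0 g : 0 <= canonical_norm mu beta N g.
Proof. exact: (riq_ge0 normN (mtilde g)). Qed.

Lemma canonical_le_ae g1 g2 : ecmeasurable g1 -> ecmeasurable g2 ->
  {ae lam, forall t, emod (g1 t) <= emod (g2 t)} ->
  canonical_norm mu beta N g1 <= canonical_norm mu beta N g2.
Proof.
move=> m1 m2 g12; apply: (riq_le_ae normN (mtilde g1) (mtilde g2)); apply: aeW => x.
rewrite [leLHS](emod_tilde _ beta_gt0) [leRHS](emod_tilde _ beta_gt0).
rewrite /tsum.
apply: lee_nneseries.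
  move=> n _ _.
  by rewrite mule_ge0 ?atom_average_ge0// lee_fin.
move=> n _.
apply: lee_wpmul2r; first by rewrite lee_fin.
apply: lee_wpmul2l; first by rewrite lee_fin invr_ge0 ltW.
apply: ge0_le_integral => //.
- by move=> t _; exact: rearr_ge0.
- by apply: measurable_funTS; exact: measurable_rearr.
- by apply: measurable_funTS; exact: measurable_rearr.
- by move=> t _; exact: rearr_le_ae.
Qed.

Lemma canonical_ecscale a g : a != 0%R -> ecmeasurable g ->
  canonical_norm mu beta N (fun t => ecscale a (g t)) =
  emod (Some a) * canonical_norm mu beta N g.
Proof.
move=> a0 mg; set c := Normc.normc a; have c0 : (0 <= c)%R.
  by rewrite -lee_fin -emodE emod_ge0.
rewrite -[RHS](_ : emod (Some (Complex c 0%R)) * N (tilde mu beta g) = _); last first.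
  by rewrite emod_real ger0_norm// emodE.
rewrite -(riq_scale normN _ (mtilde g)); congr N; apply/funext => x.
rewrite !tildeE (ecscale_of_ereal c0 (tsum_ge0 _ beta_gt0 _ _)); congr of_ereal.
rewrite /tsum -nneseriesZl//; last first.
  by move=> n _; rewrite mule_ge0 ?atom_average_ge0// lee_fin.
apply: eq_eseriesr => n _; rewrite muleA; congr (_ * _).
rewrite /atom_average muleCA; congr (_ * _).
rewrite -ge0_integralZl//; last 2 first.
- by apply: measurable_funTS; exact: measurable_rearr.
- by move=> t _; exact: rearr_ge0.
by apply: eq_integral => t _; rewrite rearr_ecscale// emodE.
Qed.

Lemma canonical0 : canonical_norm mu beta N (fun=> Some 0%R) = 0.
Proof.
have [_ [_ N0 _] _ _ _ _] := normN.
apply/N0; first exact: mtilde.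
apply: aeW => x; apply/emod_eq0; rewrite (emod_tilde _ beta_gt0).
apply: eseries0 => n _ _; rewrite /atom_average integral0_eq ?mule0 ?mul0e//.
move=> t /=; rewrite in_itv/= => /andP[nt _]; apply: rearr0.
by apply: le_trans nt; rewrite mulr_ge0// ltW.
Qed.

Hypothesis HLP_N : HLP_principle mu N.

(** Dilation by 2 gives [f^*] a distribution function at most twice that of [f], and [dist_tilde_le]
    turns this factor 2 into 3. *)
Lemma canonical_half_rearr_le f : ecmeasurable f ->
  canonical_norm mu beta N (fun t => of_ereal (rearr mu f (t / 2)%R)) <= 3%:E * N f.
Proof.
move=> mf; apply: (riq_dilate normN HLP_N _ (mtilde _) mf); first by rewrite ler1n.
move=> s s0; apply: dist_tilde_le => //; first exact: ltW.
move=> t st t0; apply: lt_le_trans (rearr_gt (ltW s0) st) _.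
apply: halfline_le.
- by rewrite mule_ge0.
- exact/measurable_emod_gt/ecmeasurable_half_rearr.
move=> u u0 /=; rewrite emod_of_ereal ?rearr_ge0// => su.
have := rearr_gt (ltW s0) su.
by rewrite -lte_pdivrMl// -EFinM mulrC.
Qed.

(** The constant is [3 * 5], with 3 from the comparison of distribution functions and 5 from the
    scaling of [tilde g] in [dist_tilde_ge]. *)
Lemma norm_le_canonical f g : ecmeasurable f -> ecmeasurable g ->
  (forall s : R, (0 < s)%R -> dist mu f s%:E <= 2%:E * dist lam g (s / 2)%:E) ->
  N f <= 15%:E * canonical_norm mu beta N g.
Proof.
move=> mf mg fg.
have : N f <= 3%:E * N (fun x => ecscale (Complex 5%R 0%R) (tilde mu beta g x)).
  apply: (riq_dilate normN HLP_N _ mf (ecmeasurable_ecscale _ (mtilde g))).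
    by rewrite ler1n.
  by move=> s s0; apply: dist_tilde_ge => //; exact: fg.
rewrite (riq_scale normN _ (mtilde g)) emod_real ger0_norm// muleA -EFinM.
by rewrite (_ : (3 * 5 = 15)%R)// -natrM.
Qed.

(** A non-null set has measure at least [beta = mu E], so the distribution function of [s] times the
    indicator of [E] is at most that of [f]. *)
Lemma norm_atom_le (E : set T) (s : R) f : ecmeasurable f -> (0 < s)%R ->
  is_atom mu E -> 0 < dist mu f s%:E ->
  N (fun x => if x \in E then Some (Complex s 0%R) else Some 0%R) <= N f.
Proof.
move=> mf s0 aE fs; have [mE _ _] := aE; rewrite -[leRHS]mul1e.
apply: (riq_dilate normN HLP_N) => //.
  by apply: ecmeasurable_restrict => //; exact: ecmeasurable_cst.
move=> r r0; rewrite mul1e; have [rs|sr] := ltP r s.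
  rewrite [leLHS](_ : _ = mu E).
    rewrite (mu_atoms aE).
    have ms := measurable_emod_gt s%:E mf.
    apply: le_trans (measure_ge_beta mu_atomic mu_atoms ms fs) _.
    apply: le_measure; rewrite ?inE; [exact: measurable_emod_gt..|].
    by move=> x /=; apply: lt_trans; rewrite lte_fin.
  congr (mu _); apply/seteqP; split => x /=.
    by case: ifPn; rewrite ?inE// emod0 lte_fin ltNge (ltW r0).
  by move=> xE; rewrite mem_set// emod_real gtr0_norm// lte_fin.
rewrite [leLHS](_ : _ = 0)// /dist (_ : mkset _ = set0) ?measure0//.
rewrite -subset0 => x /=.
by case: ifPn => _; rewrite ?emod0 ?emod_real ?gtr0_norm// lte_fin ltNge ?sr// (ltW r0).
Qed.

Lemma norm_atom_gt0 (E : set T) (s : R) : (0 < s)%R -> is_atom mu E ->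
  0 < N (fun x => if x \in E then Some (Complex s 0%R) else Some 0%R).
Proof.
move=> s0 [mE E0 _]; set h := fun x => _.
have mh : ecmeasurable h by apply: ecmeasurable_restrict => //; exact: ecmeasurable_cst.
rewrite lt0e (riq_ge0 normN)// andbT; apply/eqP.
have [_ [_ N0 _] _ _ _ _] := normN => /N0 -/(_ mh) h0.
have /negligibleP : mu.-negligible E.
  apply: negligibleS h0 => x xE /=; rewrite /h mem_set// => -[s00].
  by move: s0; rewrite s00 ltxx.
by move=> /(_ mE) E00; move: E0; rewrite E00 ltxx.
Qed.

End OneNorm.

Variables (A B : functional R T).
Hypothesis normA : ri_quasi_Banach_norm mu A.
Hypothesis normB : ri_quasi_Banach_norm mu B.
Hypothesis HLP_A : HLP_principle mu A.
Hypothesis HLP_B : HLP_principle mu B.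

Local Notation csum := (canonical_sum_norm mu beta A B).
Local Notation sumn := (sum_norm mu A B).

Lemma csum_ge0 f : 0 <= csum f.
Proof.
by apply: sum_norm_ge0 => g _;
  [exact: (canonical_ge0 normA)|exact: (canonical_ge0 normB)].
Qed.

Lemma sumn_ge0 f : 0 <= sumn f.
Proof. by apply: sum_norm_ge0 => g; [exact: (riq_ge0 normA)|exact: (riq_ge0 normB)]. Qed.

Lemma csum_le_ae f gA gB :
  Defs.space (canonical_norm mu beta A) gA -> Defs.space (canonical_norm mu beta B) gB ->
  {ae lam, forall t : measurableTypeR R, rearr mu f t <= emod (gA t) + emod (gB t)} ->
  csum f <= canonical_norm mu beta A gA + canonical_norm mu beta B gB.
Proof.
move=> sA sB fAB.
exact: (sum_norm_le_ae (canonical_le_ae normA) (canonical_le_ae normB)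
  (measurable_rearr mu f) (rearr_ge0 mu f) sA sB fAB).
Qed.

Lemma csum_le_sum f : ecmeasurable f -> csum f <= 3%:E * sumn f.
Proof.
move=> mf; rewrite -lee_pdivrMl//; apply: le_ereal_inf_tmp.
move=> _ [fA [fB [[mA finA] [mB finB] fAB ->]]]; rewrite lee_pdivrMl//.
have leA := canonical_half_rearr_le normA HLP_A mA.
have leB := canonical_half_rearr_le normB HLP_B mB.
rewrite muleDr ?ge0_adde_def// ?inE ?(riq_ge0 normA) ?(riq_ge0 normB)//.
apply: le_trans (leeD leA leB); apply: csum_le_ae.
- split; first exact: ecmeasurable_half_rearr.
  by apply: le_lt_trans leA _; rewrite lte_mul_pinfty.
- split; first exact: ecmeasurable_half_rearr.
  by apply: le_lt_trans leB _; rewrite lte_mul_pinfty.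
- by apply: aeW => t; rewrite !emod_of_ereal ?rearr_ge0//; exact: rearr_ecadd_le.
Qed.

Lemma sum_le_csum f : ecmeasurable f -> sumn f <= 15%:E * csum f.
Proof.
move=> mf; rewrite -lee_pdivrMl//; apply: le_ereal_inf_tmp.
move=> _ [gA [gB [[mA finA] [mB finB] fAB ->]]]; rewrite lee_pdivrMl//.
have [|D mD Ds] := @dist_split _ _ _ mu f gA gB mf mA mB.
  apply: (@filterS _ _ (ae_filter_ringOfSetsType lam)) fAB => t ft.
  by rewrite -[rearr _ _ _]emod_of_ereal ?rearr_ge0// ft; exact: emod_ecadd.
have mfA := ecmeasurable_restrict mD mf.
have mfB := ecmeasurable_restrict (measurableC mD) mf.
have leA := norm_le_canonical normA HLP_A mfA mA (fun s s0 => (Ds s (ltW s0)).1).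
have leB := norm_le_canonical normB HLP_B mfB mB (fun s s0 => (Ds s (ltW s0)).2).
rewrite muleDr ?ge0_adde_def// ?inE ?(canonical_ge0 normA) ?(canonical_ge0 normB)//.
apply: le_trans (leeD leA leB); apply: ereal_inf_lbound.
exists (fun x => if x \in D then f x else Some 0%R),
  (fun x => if x \in ~` D then f x else Some 0%R); split => //.
- by split => //; apply: le_lt_trans leA _; rewrite lte_mul_pinfty ?(canonical_ge0 normA).
- by split => //; apply: le_lt_trans leB _; rewrite lte_mul_pinfty ?(canonical_ge0 normB).
- apply: aeW => x; rewrite in_setC; case: ifPn => _ /=; first by rewrite ecaddr0.
  by case: (f x) => //= z; rewrite add0r.
Qed.

(** If [|f| > s] on a non-null set, then in every decomposition one part exceeds [s/2] on a non-null
    set, and [norm_atom_le] bounds the sum of the norms below by a fixed [m > 0]. *)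
Lemma sum_eq0_ae f : ecmeasurable f -> sumn f = 0 ->
  {ae mu, forall x, f x = Some 0%R}.
Proof.
move=> mf f0.
have dist0 (s : R) : (0 < s)%R -> dist mu f s%:E = 0.
  move=> s0; apply/eqP; rewrite -measure_le0 leNgt; apply/negP => fs.
  have [E [Ef aE Eb]] := atom_subset mu_atomic mu_atoms (measurable_emod_gt s%:E mf) fs.
  have [mE E0 _] := aE.
  have s20 : (0 < s / 2)%R by rewrite divr_gt0.
  pose h x : ecomplex R := if x \in E then Some (Complex (s / 2)%R 0%R) else Some 0%R.
  have A0 : 0 < A h := norm_atom_gt0 normA s20 aE.
  have B0 : 0 < B h := norm_atom_gt0 normB s20 aE.
  pose m := mine (A h) (B h).
  have m0 : 0 < m by rewrite lt_min A0 B0.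
  suff : m <= sumn f by rewrite f0 leNgt m0.
  apply: le_ereal_inf_tmp => _ [fA [fB [[mA _] [mB _] fAB ->]]].
  have [dA|/negP dA] := boolP (0 < dist mu fA (s / 2)%:E).
    apply: (@le_trans _ _ (A fA)); last by rewrite leeDl// (riq_ge0 normB).
    by rewrite ge_min (norm_atom_le normA HLP_A).
  have [dB|/negP dB] := boolP (0 < dist mu fB (s / 2)%:E).
    apply: (@le_trans _ _ (B fB)); last by rewrite leeDr// (riq_ge0 normA).
    by rewrite ge_min (norm_atom_le normB HLP_B)// orbT.
  move: fs; rewrite ltNge => /negP[].
  move: dA dB => /negP + /negP; rewrite -!leNgt => dA dB.
  rewrite -[leRHS]adde0; apply: le_trans (leeD dA dB).
  by rewrite [s in s%:E]splitr; exact: dist_ecadd_le.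
have : mu.-negligible (\bigcup_k [set x | (k.+1%:R^-1)%:E < emod (f x)]).
  apply: negligible_bigcup => k; apply/negligibleP; first exact: measurable_emod_gt.
  by apply: dist0; rewrite invr_gt0.
apply: negligibleS => x /= fx; have {}fx : emod (f x) != 0.
  by apply: contra_notN fx => /eqP/emod_eq0.
have : 0 < emod (f x) by rewrite lt0e fx emod_ge0.
case fxE : (emod (f x)) => [v||]// => [v0|_]; last first.
  by exists 0%N => //=; rewrite fxE ltry.
exists (Num.truncn v^-1) => //=; rewrite fxE lte_fin -[ltRHS]invrK.
by rewrite ltf_pV2 ?posrE ?invr_gt0// truncnS_gt.
Qed.

Lemma csum0 : csum (fun=> Some 0%R) = 0.
Proof.
apply/eqP; rewrite eq_le csum_ge0 andbT.
have m0 : ecmeasurable (fun _ : measurableTypeR R => Some 0%R : ecomplex R).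
  exact: ecmeasurable_cst.
apply: (@le_trans _ _ (canonical_norm mu beta A (fun=> Some 0%R) +
    canonical_norm mu beta B (fun=> Some 0%R))); last first.
  by rewrite (canonical0 normA) (canonical0 normB) adde0.
apply: csum_le_ae.
- by split; [exact: m0|rewrite (canonical0 normA)].
- by split; [exact: m0|rewrite (canonical0 normB)].
(* The comparison fails only at negative arguments, where [rearr] is [+oo]; these are null for the
   half-line measure. *)
exists `]-oo, 0%R[%classic; split.
- exact: measurable_itv.
- rewrite /= /mrestr (_ : _ `&` _ = set0) ?measure0// -subset0 => t /=.
  by rewrite !in_itv/= andbT => -[t0]; rewrite leNgt t0.
- move=> t tn; rewrite /= in_itv/= ltNge; apply/negP => t0; apply: tn.
  by rewrite /mkset rearr0// emod0 adde0.
Qed.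

Lemma csum_eq_ae (f g : T -> ecomplex R) : ecmeasurable f -> ecmeasurable g ->
  {ae mu, forall x, emod (f x) = emod (g x)} -> csum f = csum g.
Proof. by move=> mf mg fg; rewrite /canonical_sum_norm (rearr_eq_ae mf mg fg). Qed.

Lemma csum_ecscale a f : csum (fun x => ecscale a (f x)) = emod (Some a) * csum f.
Proof.
(* For [a = 0] the scaling law of [rearr] breaks down at negative arguments, where [rearr] is
   [+oo]. *)
have [->|a0] := eqVneq a 0%R.
  rewrite (_ : (fun x => _) = (fun=> Some 0%R)); last first.
    by apply/funext => x; rewrite ecscale0.
  by rewrite emod0 mul0e csum0.
set c := Normc.normc a; have c0 : (0 < c)%R by exact: normc_gt0.
have cn0 : Complex c 0%R != 0%R by rewrite eq_complex/= gt_eqF.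
have -> : emod (Some a) = emod (Some (Complex c 0%R)) by rewrite emod_real gtr0_norm.
rewrite /canonical_sum_norm.
rewrite (_ : (fun t => _) =
    (fun t => ecscale (Complex c 0%R) (of_ereal (rearr mu f t)))).
  apply: sum_norm_ecscale => //.
  - by move=> g _; exact: (canonical_ge0 normA).
  - by move=> g _; exact: (canonical_ge0 normB).
  - by move=> b g; exact: (canonical_ecscale normA).
  - by move=> b g; exact: (canonical_ecscale normB).
apply/funext => t; rewrite rearr_ecscale// emodE.
by rewrite (ecscale_of_ereal (ltW c0) (rearr_ge0 _ _ _)).
Qed.

(** The inequality is carried over from [A + B] by the two comparisons, which contribute 3 and 15 to
    the constant. *)
Lemma csum_triangle : exists K : R, (1 <= K)%R /\ forall f g : T -> ecomplex R,
  ecmeasurable f -> ecmeasurable g ->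
  csum (fun x => ecadd (f x) (g x)) <= K%:E * (csum f + csum g).
Proof.
have [KA [KA1 hA]] := riq_triangle normA.
have [KB [KB1 hB]] := riq_triangle normB.
pose K := Num.max KA KB.
have K1 : (1 <= K)%R by rewrite le_max KA1.
have K0 : (0 <= K)%R by exact: le_trans K1.
have hAK (f g : T -> ecomplex R) : ecmeasurable f -> ecmeasurable g ->
    A (fun x => ecadd (f x) (g x)) <= K%:E * (A f + A g).
  move=> mf mg; apply: le_trans (hA f g mf mg) _; apply: lee_wpmul2r.
    by rewrite adde_ge0// (riq_ge0 normA).
  by rewrite lee_fin le_max lexx.
have hBK (f g : T -> ecomplex R) : ecmeasurable f -> ecmeasurable g ->
    B (fun x => ecadd (f x) (g x)) <= K%:E * (B f + B g).
  move=> mf mg; apply: le_trans (hB f g mf mg) _; apply: lee_wpmul2r.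
    by rewrite adde_ge0// (riq_ge0 normB).
  by rewrite lee_fin le_max lexx orbT.
exists (3 * (K * 15))%R; split.
  have : (1 * 1 <= K * 15)%R by rewrite ler_pM// ler1n.
  by rewrite mul1r => K15; lra.
move=> f g mf mg.
apply: le_trans (csum_le_sum (ecmeasurable_ecadd mf mg)) _.
rewrite EFinM -muleA lee_pmul2l// EFinM -muleA.
apply: le_trans (sum_norm_triangle mu f g K1 (riq_ge0 normA) (riq_ge0 normB)
  hAK hBK) _.
apply: lee_wpmul2l; first by rewrite lee_fin.
rewrite muleDr// ?ge0_adde_def// ?inE ?csum_ge0//.
by apply: leeD; exact: sum_le_csum.
Qed.

Lemma csum_eq0 f : ecmeasurable f ->
  csum f = 0 <-> {ae mu, forall x, f x = Some 0%R}.
Proof.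
move=> mf; split => [f0|f0].
  apply: sum_eq0_ae => //; apply/eqP; rewrite eq_le sumn_ge0 andbT.
  by rewrite (le_trans (sum_le_csum mf))// f0 mule0.
rewrite -csum0; apply: csum_eq_ae => //; first exact: ecmeasurable_cst.
by apply: filterS f0 => x ->.
Qed.

(** Every decomposition of [g^*] dominates [f^*], so [csum_le_ae] applies to it. *)
Lemma csum_monotone (f g : T -> ecomplex R) : ecmeasurable f -> ecmeasurable g ->
  {ae mu, forall x, emod (f x) <= emod (g x)} -> csum f <= csum g.
Proof.
move=> mf mg fg; apply: le_ereal_inf_tmp => _ [gA [gB [sA sB gAB ->]]].
apply: csum_le_ae => //.
apply: (@filterS _ _ (ae_filter_ringOfSetsType lam)) gAB => t gt.
apply: le_trans (rearr_le_ae t mf mg fg) _.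
by rewrite -[rearr mu g t]emod_of_ereal ?rearr_ge0// gt; exact: emod_ecadd.
Qed.

Lemma csum_indic (E : set T) : measurable E -> mu E < +oo -> csum (chi R E) < +oo.
Proof.
move=> mE Efin.
have mchi : ecmeasurable (chi R E).
  by apply: ecmeasurable_of_ereal; apply/measurable_EFinP; exact: measurable_indic.
apply: le_lt_trans (csum_le_sum mchi) _.
apply: lte_mul_pinfty => //.
have m0 : ecmeasurable (fun _ : T => Some 0%R : ecomplex R) by exact: ecmeasurable_cst.
have B0 : B (fun=> Some 0%R) = 0.
  by have [_ [_ B0 _] _ _ _ _] := normB; apply/B0 => //; exact: aeW.
have AE : A (chi R E) < +oo by have [_ _ _ _ + _] := normA; exact.
apply: (@le_lt_trans _ _ (A (chi R E) + B (fun=> Some 0%R))); last by rewrite B0 adde0.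
apply: ereal_inf_lbound; exists (chi R E), (fun=> Some 0%R); split => //.
- by split => //; rewrite B0.
- by apply: aeW => x; rewrite ecaddr0.
Qed.

End CanonicalSum.

Theorem theorem2p2 (R : realType) (d : measure_display) (T : measurableType d)
    (mu : {sigma_finite_measure set T -> \bar R}) (beta : R)
    (A B : functional R T)
    (beta_gt0 : (0 < beta)%R)
    (mu_atomic : completely_atomic mu)
    (mu_atoms : forall E : set T, is_atom mu E -> mu E = beta%:E)
    (normA : ri_quasi_Banach_norm mu A)
    (normB : ri_quasi_Banach_norm mu B)
    (HLP_A : HLP_principle mu A)
    (HLP_B : HLP_principle mu B) :
  (exists c C : R, [/\ (0 < c)%R, (c <= C)%R &
     forall f : T -> ecomplex R, ecmeasurable f ->
       c%:E * canonical_sum_norm mu beta A B f <= sum_norm mu A B f /\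
       sum_norm mu A B f <= C%:E * canonical_sum_norm mu beta A B f]) /\
  [/\ is_functional mu (canonical_sum_norm mu beta A B),
      quasinorm mu (canonical_sum_norm mu beta A B),
      lattice_property mu (canonical_sum_norm mu beta A B),
      finite_on_finite_sets mu (canonical_sum_norm mu beta A B) &
      rearrangement_invariant mu (canonical_sum_norm mu beta A B)] /\
  (local_L1 mu (canonical_sum_norm mu beta A B) <->
   local_L1 mu (sum_norm mu A B)).
Proof.
have mu_sigma : sigma_finite setT mu := sigma_finiteT mu.
have le1 f := @csum_le_sum _ _ _ mu beta mu_sigma beta_gt0 mu_atomic mu_atoms
  A B normA normB HLP_A HLP_B f.
have le2 f := @sum_le_csum _ _ _ mu beta mu_sigma beta_gt0 mu_atomic mu_atoms
  A B normA normB HLP_A HLP_B f.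
have c0 f : 0 <= canonical_sum_norm mu beta A B f by exact: csum_ge0.
have s0 f : 0 <= sum_norm mu A B f by exact: sumn_ge0.
split; last split.
- exists (3^-1)%R, 15%R; split; first by rewrite invr_gt0.
    by lra.
  by move=> f mf; split; [rewrite lee_pdivrMl//; exact: le1|exact: le2].
- split.
  + split => [f _|f g mf mg fg|f mf]; first exact: c0.
      by apply: csum_eq_ae => //; apply: filterS fg => x ->.
    apply: csum_eq_ae => //; first exact: ecmeasurable_eabs.
    by apply: aeW => x; exact: emod_eabs.
  + split.
    * by move=> a f _; exact: (csum_ecscale mu_sigma).
    * by move=> f mf; exact: (csum_eq0 mu_sigma).
    * have [K [K1 hK]] := csum_triangle mu_sigma beta_gt0 mu_atomic mu_atoms
        normA normB HLP_A HLP_B.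
      by exists K; split => // f g [mf _] [mg _]; exact: hK.
  + by move=> f g [mf _] [mg _]; exact: (csum_monotone mu_sigma).
  + by move=> E mE Efin; exact: (csum_indic mu_sigma).
  + move=> f g mf mg fg; rewrite /canonical_sum_norm.
    rewrite (_ : rearr mu f = rearr mu g)//; apply/funext => t.
    (* The hypothesis concerns [t >= 0]; at negative arguments both rearrangements are [+oo]. *)
    have [t0|t0] := leP 0%R t; first exact: fg.
    by rewrite !rearr_neg.
- by split; [exact: (local_L1_le (K := 3))|exact: (local_L1_le (K := 15))].
Qed.
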